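(* Let $q\geqslant 3$ be a prime number. Let $\mathfrak{A}=\{\boldsymbol{\mu}_n\rtimes_\chi\boldsymbol{\mu}_q\}_{(n,\chi)\in\mathfrak{K}}$ be a Frobenius consistent balanced collection (with respect to the prime $l=q$). Then there exist a field $\Bbbk\subset\overline{\mathbb{F}_q}$ and a non-trivial Severi--Brauer variety $X$ of dimension $q-1$ over $\mathbb{K}=\Bbbk(t)$, where $t$ is a transcendental variable, such that $\operatorname{Aut}(X)$ contains (a subgroup isomorphic to) every group $\boldsymbol{\mu}_n\rtimes_\chi\boldsymbol{\mu}_q\in\mathfrak{A}$, and for any positive integer $N$ the group $\boldsymbol{\mu}_q^N$ also acts (faithfully) on $X$.
   Context: A Severi--Brauer variety of dimension $m-1$ over a field $\mathbb{K}$ is an algebraic variety over $\mathbb{K}$ that becomes isomorphic to $\mathbb{P}^{m-1}$ after base change to an algebraic closure of $\mathbb{K}$; it is non-trivial if it is not isomorphic to $\mathbb{P}^{m-1}_{\mathbb{K}}$ over $\mathbb{K}$. $\boldsymbol{\mu}_n$ is the cyclic group of order $n$; $\boldsymbol{\mu}_n^*$ is the multiplicative group of residues modulo $n$ coprime to $n$, identified with $\operatorname{Aut}(\boldsymbol{\mu}_n)$ ($r$ acts by $x\mapsto x^r$). For a prime $q$, $\mathfrak{I}_q$ is the set of positive integers divisible only by primes congruent to $1$ modulo $q$. For $n=\prod_i p_i^{r_i}\in\mathfrak{I}_q$ one has canonically $\boldsymbol{\mu}_n^*\cong\prod_i\boldsymbol{\mu}_n(p_i)^*$ with $\boldsymbol{\mu}_n(p_i)^*\cong\boldsymbol{\mu}_{p_i^{r_i}}^*\cong\boldsymbol{\mu}_{p_i-1}\times\boldsymbol{\mu}_{p_i^{r_i-1}}$.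 A homomorphism $\chi:\boldsymbol{\mu}_q\to\boldsymbol{\mu}_n^*$ is balanced if its composition with each projection $\boldsymbol{\mu}_n^*\to\boldsymbol{\mu}_n(p_i)^*$ is injective. The image of any $\chi:\boldsymbol{\mu}_q\to\boldsymbol{\mu}_n^*$ lies in $\prod_{p\mid n}\boldsymbol{\mu}_{p-1}$, where $\boldsymbol{\mu}_{p-1}$ is the subgroup of order $p-1$ in $\boldsymbol{\mu}_{p^r}^*$ (identified for different $r$ via reduction modulo $p$). For $t\mid n$ let $\pi_{n,t}:\prod_{p\mid n}\boldsymbol{\mu}_{p-1}\to\prod_{p\mid t}\boldsymbol{\mu}_{p-1}$ be the projection. For $\chi_i:\boldsymbol{\mu}_q\to\boldsymbol{\mu}_{n_i}^*$, $i=1,2$, and $t=\gcd(n_1,n_2)$, the pair $(\operatorname{Im}\chi_1,\operatorname{Im}\chi_2)$ is consistent if $\pi_{n_1,t}(\operatorname{Im}\chi_1)=\pi_{n_2,t}(\operatorname{Im}\chi_2)$. A collection $\{\boldsymbol{\mu}_n\rtimes_\chi\boldsymbol{\mu}_q\}_{(n,\chi)\in\mathfrak{K}}$, where $\mathfrak{K}$ is a set of pairs with $n\in\mathfrak{I}_q$ and $\chi:\boldsymbol{\mu}_q\to\boldsymbol{\mu}_n^*$ balanced, is a consistent balanced collection if $(\operatorname{Im}\chi_1,\operatorname{Im}\chi_2)$ is consistent for all $(n_1,\chi_1),(n_2,\chi_2)\in\mathfrak{K}$. For a prime $l$ (here $l=q$) and $\gcd(n,l)=1$, $\operatorname{ord}_n(l)$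 is the minimal positive integer $r$ such that $n\mid l^r-1$; $v_q(m)$ is the maximal $r$ with $q^r\mid m$. A balanced $\chi:\boldsymbol{\mu}_q\to\boldsymbol{\mu}_n^*$ is of Frobenius type if, for a generator $y$ of $\boldsymbol{\mu}_q$, $\chi(y)$ is the automorphism $x\mapsto x^{l^{d_0\cdot d\cdot q^{k-1}}}$ of $\boldsymbol{\mu}_n$, where $\operatorname{ord}_n(l)=q^kd_0$ with $k\geqslant 1$, $q\nmid d_0$, and $1\leqslant d\leqslant q-1$; for $n=1$ this condition is void. For a positive integer $k$, $\mathfrak{I}_{k,q,l}$ is the set of positive integers divisible only by primes $p\neq l$ with $p\equiv 1\pmod q$ and $v_q(\operatorname{ord}_p(l))=k$. A consistent balanced collection is Frobenius if there is one positive integer $k$ such that all occurring $n$ lie in $\mathfrak{I}_{k,q,l}$ and all occurring $\chi$ are of Frobenius type. *)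

(* Defs.v *)
From HB Require Import structures.
From mathcomp Require Import all_boot all_algebra all_fingroup all_solvable.
From mathcomp Require Import generic_quotient mpoly.

Set Implicit Arguments.
Unset Strict Implicit.
Unset Printing Implicit Defensive.

Import GRing.Theory GroupScope.
Local Open Scope ring_scope.

(** * Points of projective space *)

Section ProjectiveSpace.

Variables (F : fieldType) (n : nat).

Definition nzvec := {v : 'rV[F]_n.+1 | v != 0}.

Definition proportional : rel nzvec := fun u v => (val u == val v)%MS.

Lemma proportional_refl : reflexive proportional.
Proof. by move=> u; rewrite /proportional submx_refl. Qed.

Lemma proportional_sym : ssrbool.symmetric proportional.
Proof. by move=> u v; rewrite /proportional andbC. Qed.

Lemma proportional_trans : transitive proportional.
Proof.
move=> v u w /andP[uv vu] /andP[vw wv].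
by rewrite /proportional (submx_trans uv vw) (submx_trans wv vu).
Qed.

Canonical proportional_equiv :=
  EquivRel proportional proportional_refl proportional_sym proportional_trans.

(* The set of F-points of the projective n-space with homogeneous coordinates
   x_0, ..., x_n. *)
Definition proj_point := {eq_quot proportional_equiv}%qT.

Definition coords (P : proj_point) : 'rV[F]_n.+1 := val (repr P).

Definition has_coords (P : proj_point) (v : 'rV[F]_n.+1) : Prop :=
  v != 0 /\ (coords P == v)%MS.

End ProjectiveSpace.

(* The value of p at the vector v, the coefficients of p being sent to the
   larger field by iota. *)
Definition eval_at (F L : fieldType) (iota : {rmorphism F -> L}) (n : nat)
    (p : {mpoly F[n]}) (v : 'rV[L]_n) : L :=
  (map_mpoly iota p).@[fun i => v 0 i].

(** * Projective varieties *)

(* A closed subscheme Proj F[x_0, ..., x_n]/I of projective space over F, given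
   by homogeneous generators of I. *)
Record proj_scheme (F : fieldType) := ProjScheme {
  ambient : nat;
  forms : {mpoly F[ambient.+1]} -> Prop;
  forms_homog : forall p, forms p -> exists d, p \is d.-homog
}.

Definition proj_space (F : fieldType) (n : nat) : proj_scheme F :=
  @ProjScheme F n (fun=> False) (fun _ H => match H with end).

Definition point_of (F L : fieldType) (iota : {rmorphism F -> L})
    (X : proj_scheme F) (P : proj_point L (ambient X)) : Prop :=
  forall p, forms p -> eval_at iota p (coords P) = 0.

Lemma map_mpoly_homog (F L : fieldType) (iota : {rmorphism F -> L}) (n d : nat)
    (p : {mpoly F[n]}) : p \is d.-homog -> map_mpoly iota p \is d.-homog.
Proof.
move/dhomogP=> hp; apply/dhomogP=> m.
rewrite mcoeff_msupp mcoeff_map_mpoly => nz; apply: hp.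
by rewrite mcoeff_msupp; apply: contra_neq nz => /= ->; rewrite raddf0.
Qed.

Section BaseChange.

Variables (F L : fieldType) (iota : {rmorphism F -> L}) (X : proj_scheme F).

Definition base_change_forms (p : {mpoly L[(ambient X).+1]}) : Prop :=
  exists2 p0, forms p0 & p = map_mpoly iota p0.

Lemma base_change_forms_homog p :
  base_change_forms p -> exists d, p \is d.-homog.
Proof.
by case=> p0 /forms_homog[d hd] ->; exists d; apply: map_mpoly_homog.
Qed.

Definition base_change : proj_scheme L := ProjScheme base_change_forms_homog.

End BaseChange.

(* The homogeneous ideal of X, with L algebraically closed, is the full vanishing
   ideal of the set of points of X; in particular X is a reduced scheme, and it
   is determined by its points.  Every reduced closed subscheme of projective
   space has such a presentation. *)
Definition reduced (L : closedFieldType) (X : proj_scheme L) : Prop :=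
  forall (d : nat) (p : {mpoly L[(ambient X).+1]}), p \is d.-homog ->
    (forall P, point_of idfun P -> eval_at idfun p (coords P) = 0) ->
  exists s : seq ({mpoly L[(ambient X).+1]} * {mpoly L[(ambient X).+1]}),
    (forall cg, cg \in s -> forms cg.2) /\ p = \sum_(cg <- s) cg.1 * cg.2.

(** * Morphisms over F *)

(* Geometrically reduced varieties over F and their F-morphisms are described by
   points over an algebraically closed L containing F: an F-morphism is a map
   on L-points which is given, in an F-open neighbourhood {Q | h Q <> 0} of each
   L-point, by forms h of the same degree with coefficients in F.  The values
   of f outside X are irrelevant. *)
Section Morphisms.

Variables (F : fieldType) (L : closedFieldType) (iota : {rmorphism F -> L}).

Definition regular_map (X Y : proj_scheme F)
    (f : proj_point L (ambient X) -> proj_point L (ambient Y)) : Prop :=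
  (forall P, point_of iota P -> point_of iota (f P)) /\
  forall P, point_of iota P ->
  exists (d : nat) (h : 'I_(ambient Y).+1 -> {mpoly F[(ambient X).+1]}),
    let hv Q := \row_i eval_at iota (h i) (coords Q) in
    [/\ forall i, h i \is d.-homog,
        hv P != 0
      & forall Q, point_of iota Q -> hv Q != 0 -> has_coords (f Q) (hv Q)].

Definition inverse_maps (X Y : proj_scheme F)
    (f : proj_point L (ambient X) -> proj_point L (ambient Y))
    (g : proj_point L (ambient Y) -> proj_point L (ambient X)) : Prop :=
  (forall P, point_of iota P -> g (f P) = P) /\
  (forall Q, point_of iota Q -> f (g Q) = Q).

Definition isomorphism (X Y : proj_scheme F)
    (f : proj_point L (ambient X) -> proj_point L (ambient Y)) : Prop :=
  regular_map f /\ exists2 g, regular_map g & inverse_maps f g.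

Definition isomorphic (X Y : proj_scheme F) : Prop :=
  exists f : proj_point L (ambient X) -> proj_point L (ambient Y),
    isomorphism f.

(* Aut(X) over F contains a subgroup isomorphic to gT; equivalently gT acts
   faithfully on X by automorphisms over F. *)
Definition embeds_in_Aut (gT : finGroupType) (X : proj_scheme F) : Prop :=
  exists rho : gT -> proj_point L (ambient X) -> proj_point L (ambient X),
    [/\ forall g, isomorphism (X := X) (Y := X) (rho g),
        forall g h P, point_of iota P -> rho (g * h)%g P = rho g (rho h P)
      & forall g h, (forall P, point_of iota P -> rho g P = rho h P) -> g = h].

End Morphisms.

Arguments regular_map {F L} iota X Y f.
Arguments inverse_maps {F L} iota X Y f g.
Arguments isomorphism {F L} iota X Y f.
Arguments isomorphic {F L} iota X Y.
Arguments embeds_in_Aut {F L} iota gT X.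

(* L is meant to be an algebraic closure of F via iota.  The base change of X to
   L is a variety isomorphic to projective n-space over L; irreducibility, over
   L and over F, follows from the isomorphism. *)
Definition Severi_Brauer (F : fieldType) (L : closedFieldType)
    (iota : {rmorphism F -> L}) (n : nat) (X : proj_scheme F) : Prop :=
  reduced (base_change iota X) /\
  isomorphic idfun (base_change iota X) (proj_space L n).

Definition nontrivial_Severi_Brauer (F : fieldType) (L : closedFieldType)
    (iota : {rmorphism F -> L}) (n : nat) (X : proj_scheme F) : Prop :=
  Severi_Brauer iota n X /\ ~ isomorphic iota X (proj_space F n).

(** * Semidirect products of cyclic groups *)

(* mu_n is the group Zp n, written additively, and mu_n^* is {unit 'Z_n}.  Both
   are correct for n = 1 as well: 'Z_1 is Z/2, but Zp 1 is the trivial subgroup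
   and {unit 'Z_1} is trivial. *)
Notation mu_hom q n := {morphism Zp q >-> {unit 'Z_n}}.

Lemma unit_Zp_le1 (n : nat) (u : {unit 'Z_n}) : (n <= 1)%N -> val u = 1.
Proof.
case: n u => [|[|//]] [[[|[|//]] ?] u_unit] _; try by apply/val_inj.
all: by move: u_unit; rewrite unitr0.
Qed.

Section SemidirectProduct.

Variables (q n : nat) (chi : mu_hom q n).

Definition chi_act (x : 'Z_n) (y : 'Z_q) : 'Z_n := x * val (chi y).

Lemma chi_act_is_action : is_action (Zp q) chi_act.
Proof.
split=> [y|x y z Dy Dz]; first exact: mulIr (valP (chi y)).
by rewrite /chi_act morphM //= mulrA.
Qed.

Canonical chi_action := Action chi_act_is_action.

Lemma chi_act_is_groupAction : is_groupAction (Zp n) chi_action.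
Proof.
move=> y Dy; rewrite inE; apply/andP; split.
  apply/subsetP=> x; rewrite inE /= actpermE /= /chi_act.
  case: (ltnP 1 n) => [n_gt1|n_le1]; first by rewrite mem_Zp.
  by rewrite unit_Zp_le1 // mulr1 eqxx.
apply/morphicP=> x1 x2 _ _; rewrite !actpermE /=.
by rewrite /chi_act [(x1 * x2)%g]/(x1 + x2) mulrDl.
Qed.

Definition chi_groupAction := GroupAction chi_act_is_groupAction.

(* In sdprod_by the conjugate of x by y is y^-1 x y = chi(y)(x); composing with
   y |-> y^-1 identifies this with the convention y x y^-1 = chi(y)(x). *)
Definition mu_sdprod : finGroupType := sdprod_by chi_groupAction.

End SemidirectProduct.

(** * Consistent balanced collections *)

Local Open Scope nat_scope.

Definition in_I (q n : nat) : Prop :=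
  (0 < n) /\ forall p, prime p -> p %| n -> p = 1 %[mod q].

(* n`_p is the power of p in n, and mu_n(p)^* is identified with the units
   modulo n`_p. *)
Definition balanced (q n : nat) (chi : mu_hom q n) : Prop :=
  forall p, prime p -> p %| n ->
    {in Zp q &, injective (fun y => (val (chi y) : nat) %% n`_p)}.

(* The restriction of pi_{n,t} to Im chi: for p | t the component in mu_{p-1} is
   recorded by its residue modulo p. *)
Definition pi_image (q n t : nat) (chi : mu_hom q n) : seq (seq nat) :=
  [seq [seq (val (chi y) : nat) %% p | p <- primes t] | y in Zp q].

Definition consistent (q n1 n2 : nat) (chi1 : mu_hom q n1) (chi2 : mu_hom q n2)
    : Prop :=
  let t := gcdn n1 n2 in pi_image t chi1 =i pi_image t chi2.

Definition collection (q : nat) := forall n : nat, mu_hom q n -> Prop.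

Definition consistent_balanced (q : nat) (C : collection q) : Prop :=
  (forall n (chi : mu_hom q n), C n chi -> in_I q n /\ balanced chi) /\
  (forall n1 n2 (chi1 : mu_hom q n1) (chi2 : mu_hom q n2),
     C n1 chi1 -> C n2 chi2 -> consistent chi1 chi2).

(** * Frobenius collections *)

Definition is_ord (n l r : nat) : Prop :=
  [/\ (0 < r), n %| l ^ r - 1
    & forall r', (0 < r') -> n %| l ^ r' - 1 -> (r <= r')].

Definition Frobenius_type (l q n : nat) (chi : mu_hom q n) : Prop :=
  n = 1%N \/
  exists (y : 'Z_q) (k d0 d : nat),
    [/\ generator (Zp q) y,
        is_ord n l (q ^ k * d0),
        (1 <= k) /\ ~~ (q %| d0),
        (1 <= d <= q - 1)
      & (val (chi y) : nat) = l ^ (d0 * d * q ^ (k - 1)) %[mod n]].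

Definition in_I_Frob (k q l n : nat) : Prop :=
  (0 < n) /\
  forall p, prime p -> p %| n ->
    [/\ p <> l, p = 1 %[mod q] & exists2 r, is_ord p l r & logn q r = k].

Definition Frobenius_collection (l q : nat) (C : collection q) : Prop :=
  consistent_balanced C /\
  exists k : nat, (0 < k) /\
    forall n (chi : mu_hom q n), C n chi ->
      in_I_Frob k q l n /\ Frobenius_type l chi.

(* Main.v *)
From Stdlib Require Import Classical ClassicalEpsilon.
Require Import Defs.
From HB Require Import structures.
From mathcomp Require Import all_boot all_algebra all_fingroup all_solvable.
From mathcomp Require Import generic_quotient mpoly.
From mathcomp Require Import separable cyclotomic ring zify.
Set Implicit Arguments.
Unset Strict Implicit.
Unset Printing Implicit Defensive.
Import GRing.Theory GroupScope.
Local Open Scope ring_scope.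

(** Let kappa be the common q-adic valuation of the orders of q modulo the primes that
    occur, let ep = q^(kappa-1), and let k be the union of the finite fields with
    q^(ep m) elements, m prime to q, inside an algebraic closure of the prime field.
    Choose x0 with x0^(q^ep) = x0 + 1.  Then al = x0^q - x0 lies in k, and k(x0)/k is
    cyclic of degree q with generator xi |-> xi + 1.  Over K = k(t) this gives the cyclic
    algebra A generated by xi and u with xi^q - xi = al, u^q = t and
    u xi u^-1 = xi + 1.  The variety X is the Severi-Brauer variety of A, and the groups
    are found in the group A^*/K^*, which acts on X.

    The variety.  Over a closed field L containing K, with roots x of xi^q - xi - al and
    r of r^q - t, the algebra A becomes the matrix algebra of L^q.  The twisted Galois
    action on L^q permutes the coordinates cyclically up to the scalar t; on the q-th
    tensor power that scalar can be divided out.  So the tensors v_(f 0) ... v_(f (q-1))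
    have coordinates phi for which their locus is defined over K.  X is given by all forms
    over K that vanish on the image of phi.  By linear algebra (form_descent) these
    generate over L all forms vanishing on the image; hence X is reduced, and the evident
    binomial relations among tensors hold on X and invert phi (SB_Severi_Brauer).

    Nontriviality.  A point of X over K gives Y0 and Y1 in K(xi) with
    t N(Y0) = N(Y1) and Y0 <> 0 (trivial_norm).  Conjugates over K have the same t-adic
    valuation, so that norms have valuations divisible by q (not_norm).

    Automorphisms.  An element of A acts on L^q by a matrix, and the induced map on
    tensors is linear with coefficients in K (phi_alg_mx, embeds_in_Aut_SB).
    - The extension K(u)/K is purely inseparable of degree q, so K(u)^*/K^* has exponent
      q; the classes of 1 + t^i u are independent in it (elementary_abelian_embeds).
    - For n in the collection, the condition on kappa says that a primitive n-th root of
      unity zeta lies in k(x0) while no nontrivial power of zeta lies in k.  Conjugation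
      by u restricts on the powers of zeta to a generator of the group of automorphisms
      that contains chi(y), so that a suitable power of u and zeta generate the
      semidirect product modulo K^* (Frobenius_element, semidirect_embeds). *)

Local Notation tofrac := (@FracField.tofrac _).

(** * Residues modulo q and Artin-Schreier polynomials *)

Section ArtinSchreier.

Variable p : nat.
Local Notation q := p.+2.
Implicit Types i j l : 'I_q.

(** The class of i in the prime field, in characteristic q. Writing q as p.+2 gives 'I_q
    its ring structure Z/q. *)
Definition res (R : nzRingType) i : R := (i : nat)%:R.

Lemma rmorph_res (R S : nzRingType) (f : {rmorphism R -> S}) i : f (res R i) = res S i.
Proof. exact: rmorph_nat. Qed.

Lemma res0 (R : nzRingType) : res R 0 = 0. Proof. by []. Qed.

Lemma resD (R : nzRingType) (chR : q \in [pchar R]) i j : res R (i + j) = res R i + res R j.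
Proof. by rewrite /res -natrD (GRing.natr_mod_pchar chR). Qed.

Lemma res_nat (R : nzRingType) (chR : q \in [pchar R]) m : res R m%:R = m%:R.
Proof. by rewrite /res Zp_nat /= (GRing.natr_mod_pchar chR). Qed.

Lemma resN (R : nzRingType) (chR : q \in [pchar R]) i : res R (- i) = - res R i.
Proof. by apply/eqP; rewrite -addr_eq0 -resD // addNr res0. Qed.

Lemma res_inj (R : nzRingType) (chR : q \in [pchar R]) : injective (res R).
Proof.
move=> i j /eqP; rewrite -subr_eq0 -resN // -resD // -(dvdn_pcharf chR) => /dvdnP[m e].
apply/eqP; rewrite -subr_eq0; apply/eqP/val_inj; rewrite [LHS]e.
case: m e => [|m] e //; have := ltn_ord (i - j).
by rewrite e mulSn ltnNge leq_addr.
Qed.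

Lemma frobD (R : comNzRingType) (chR : q \in [pchar R]) (x y : R) :
  (x + y) ^+ q = x ^+ q + y ^+ q.
Proof. by rewrite -!(pFrobenius_autE chR) pFrobenius_autD_comm //; apply: mulrC. Qed.

Lemma frobB (R : comNzRingType) (chR : q \in [pchar R]) (x y : R) :
  (x - y) ^+ q = x ^+ q - y ^+ q.
Proof. by rewrite -!(pFrobenius_autE chR) pFrobenius_autB_comm //; apply: mulrC. Qed.

Lemma frob_res (R : nzRingType) (chR : q \in [pchar R]) i : res R i ^+ q = res R i.
Proof. by rewrite -(pFrobenius_autE chR) pFrobenius_aut_nat. Qed.

(** In characteristic q the sum over j of A^(q-1-j) B^j is (A - B)^(q-1); when A and B
    are roots of the same Artin-Schreier polynomial, A - B lies in the prime field, and
    this is 1 for A <> B and 0 for A = B. So trace coordinates with respect to the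
    powers of xi can be inverted without a matrix inverse, by a formula with integer
    coefficients. *)
Lemma trace_dual (F : fieldType) (chF : q \in [pchar F]) (x : F) (c y : 'I_q -> F) l :
  (forall j, y j = \sum_i (x + res F i) ^+ j * c i) ->
  y 0 - \sum_j y (rev_ord j) * (x + res F l) ^+ j = c l.
Proof.
move=> hy; rewrite hy; under eq_bigr do rewrite expr0 mul1r.
rewrite [X in _ - X](eq_bigr (fun j : 'I_q => \sum_i c i *
    ((x + res F i) ^+ (q.-1 - j) * (x + res F l) ^+ j))); last first.
  move=> j _; rewrite hy mulr_suml; apply: eq_bigr => i _ /=.
  by rewrite subSS mulrAC mulrC.
rewrite exchange_big /= -sumrB (bigD1 l) //= [X in _ + X]big1 => [|i nil].
  rewrite addr0 -mulr_sumr (eq_bigr (fun=> (x + res F l) ^+ p.+1)).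
    by rewrite sumr_const card_ord -mulr_natr (pcharf0 chF) !mulr0 subr0.
  by move=> j _; rewrite -exprD subnK // -ltnS.
rewrite -mulr_sumr -[X in X - _]mulr1 -mulrBr.
apply/eqP; rewrite mulf_eq0 subr_eq0; apply/orP; right.
have dE : x + res F i - (x + res F l) = res F i - res F l.
  by rewrite opprD addrACA subrr add0r.
have nz : x + res F i - (x + res F l) != 0.
  by rewrite dE subr_eq0 (inj_eq (res_inj chF)).
apply/eqP/(mulfI nz); rewrite -subrXX mulr1.
by rewrite -frobB // dE frobB // !frob_res.
Qed.

Definition AS (R : nzRingType) (a : R) : {poly R} := 'X^q - 'X - a%:P.

Lemma size_AS (R : nzRingType) (a : R) : size (AS a) = q.+1.
Proof.
rewrite /AS -addrA size_polyDl ?size_polyXn //.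
rewrite (leq_ltn_trans (size_polyD _ _)) // !size_polyN size_polyX size_polyC.
by case: eqP.
Qed.

Lemma monic_AS (R : nzRingType) (a : R) : AS a \is monic.
Proof.
rewrite monicE lead_coefE size_AS /AS !coefB coefXn eqxx coefX coefC /=.
by rewrite !subr0.
Qed.

Lemma map_AS (R S : nzRingType) (f : {rmorphism R -> S}) (a : R) :
  map_poly f (AS a) = AS (f a).
Proof. by rewrite /AS !rmorphB /= map_polyXn map_polyX map_polyC. Qed.

Section OverField.
Variables (F : fieldType) (chF : q \in [pchar F]).

Lemma root_AS (x a : F) i : x ^+ q - x = a -> root (AS a) (x + res F i).
Proof.
move=> <-; rewrite /root /AS !hornerE.
rewrite frobD // frob_res //.
by rewrite opprD addrACA subrr addr0 subrr.
Qed.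

Lemma AS_dvdP (x a : F) (P : {poly F}) : x ^+ q - x = a ->
  reflect (forall i, P.[x + res F i] = 0) (AS a %| P).
Proof.
move=> xa; apply: (iffP idP) => [/dvdpP[Q ->] i | h].
  by rewrite hornerM (rootP (root_AS i xa)) mulr0.
pose rs := [seq x + res F i | i <- enum 'I_q].
have Urs : uniq_roots rs.
  by rewrite uniq_rootsE map_inj_uniq ?enum_uniq // => i j /addrI /(res_inj chF).
have -> : AS a = \prod_(z <- rs) ('X - z%:P).
  rewrite [LHS](@all_roots_prod_XsubC _ _ rs) //.
  - by rewrite (monicP (monic_AS a)) scale1r.
  - by rewrite size_AS size_map size_enum_ord.
  - by apply/allP=> _ /mapP[i _ ->]; apply: root_AS.
apply: uniq_roots_dvdp => //.
by apply/allP=> _ /mapP[i _ ->]; apply/rootP.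
Qed.

End OverField.

(** Identities between conjugates move from one extension of F to another through this
    divisibility, in which the extension does not occur. *)
Lemma AS_dvd_map (F L : fieldType) (iota : {rmorphism F -> L}) (chF : q \in [pchar F])
    (x : L) (a : F) (P : {poly F}) : x ^+ q - x = iota a ->
  reflect (forall i, (map_poly iota P).[x + res L i] = 0) (AS a %| P).
Proof.
move=> xa; rewrite -(dvdp_map iota) map_AS.
by apply: AS_dvdP => //; rewrite (fmorph_pchar iota).
Qed.

End ArtinSchreier.

(** * Evaluating forms *)

Section Evaluation.

Variable n : nat.

Lemma rmorph_mmap (R : nzRingType) (S S' : comNzRingType) (phi : {rmorphism S -> S'})
    (f : R -> S) (h : 'I_n -> S) (P : {mpoly R[n]}) :
  phi (mmap f h P) = mmap (phi \o f) (phi \o h) P.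
Proof.
rewrite /mmap rmorph_sum; apply: eq_bigr => m _; rewrite rmorphM; congr (_ * _).
by rewrite /mmap1 rmorph_prod; apply: eq_bigr => i _; rewrite rmorphXn.
Qed.

Lemma eq_mmap (R S : nzRingType) (f f' : R -> S) (h h' : 'I_n -> S) :
  f =1 f' -> h =1 h' -> mmap f h =1 mmap f' h'.
Proof.
move=> ef eh P; apply: eq_bigr => m _.
by rewrite ef (mmap1_eq _ eh).
Qed.

Lemma mmap_map_mpoly (R R' S : nzRingType) (g : {rmorphism R' -> S})
    (f : {rmorphism R -> R'}) (h : 'I_n -> S) (P : {mpoly R[n]}) :
  mmap g h (map_mpoly f P) = mmap (g \o f) h P.
Proof.
pose d := maxn (msize P) (msize (map_mpoly f P)).
rewrite (mmapE d) ?leq_maxr // (mmapE d) ?leq_maxl //.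
by apply: eq_bigr => m _; rewrite mcoeff_map_mpoly.
Qed.

Lemma mmap_homog (R : nzRingType) (S : comNzRingType) (f : R -> S) (h : 'I_n -> S) (c : S) d
    (P : {mpoly R[n]}) : P \is d.-homog ->
  mmap f (fun i => c * h i) P = c ^+ d * mmap f h P.
Proof.
move=> /dhomogP hP; rewrite /mmap mulr_sumr; apply: eq_big_seq => m /hP <-.
rewrite mulrCA; congr (_ * _); rewrite /mmap1 [mf in c ^+ mf]mdegE -prodrXr -big_split /=.
by apply: eq_bigr => i _; rewrite exprMn.
Qed.

Lemma eval_atE (F L : fieldType) (iota : {rmorphism F -> L}) (P : {mpoly F[n]})
    (v : 'rV[L]_n) : eval_at iota P v = mmap iota (v 0) P.
Proof. by rewrite /eval_at /meval mmap_map_mpoly; apply: eq_mmap. Qed.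

Lemma eval_at_homog (F L : fieldType) (iota : {rmorphism F -> L}) (P : {mpoly F[n]})
    (v : 'rV[L]_n) c d : P \is d.-homog ->
  eval_at iota P (c *: v) = c ^+ d * eval_at iota P v.
Proof.
move=> hP; rewrite !eval_atE -mmap_homog //; apply: eq_mmap => // i.
by rewrite mxE.
Qed.

End Evaluation.

(** * Linear systems under field extension *)

Section KernelDescent.

Variables (K L : fieldType) (iota : {rmorphism K -> L}) (M : nat).

(** Independent rows satisfying T number at most M; a choice with the largest possible
    number of rows spans the others. *)
Lemma finite_subsystem (T : 'rV[K]_M -> Prop) :
  exists r (A : 'M[K]_(r, M)),
    (forall i, T (row i A)) /\ forall tau, T tau -> (tau <= A)%MS.
Proof.
pose P r := exists A : 'M[K]_(r, M), row_free A /\ forall i, T (row i A).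
have P0 : P 0%N by exists 0; split=> [|[]//]; rewrite /row_free mxrank0.
have [r [[A [fA TA]] nP]] : exists r, P r /\ ~ P r.+1.
  apply: NNPP => h; suff /(_ M.+1)[A [/eqP fA _]]: forall r, P r.
    by have := rank_leq_col A; rewrite fA ltnn.
  by elim=> // r Pr; apply: NNPP => nP; apply: h; exists r.
exists r, A; split=> // tau Ttau; apply/negPn/negP => ntau; apply: nP.
rewrite -addn1; exists (col_mx A tau); split=> [|i]; last first.
  case: (splitP i) => j e.
    by rewrite (_ : i = lshift 1 j) ?rowKu //; apply/val_inj.
  rewrite (_ : i = rshift r j) ?rowKd; last exact/val_inj.
  by rewrite (_ : row j tau = tau) //; apply/rowP=> l; rewrite ord1 mxE.
rewrite /row_free eqn_leq rank_leq_row /= -addsmxE.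
apply: (@leq_trans (\rank A).+1); first by rewrite (eqP fA) addn1.
apply: rank_ltmx; rewrite ltmxE addsmxSl /=.
by apply: contra ntau => /(submx_trans (addsmxSr A tau)).
Qed.

(** Gaussian elimination commutes with field extension, so the solutions over L of a
    linear system over K are combinations of solutions over K. An infinite system is
    first reduced to a finite one. *)
Lemma kernel_descent (T : 'rV[K]_M -> Prop) (w : 'rV[L]_M) :
  (forall tau, T tau -> w *m (map_mx iota tau)^T = 0) ->
  exists (B : 'M[K]_M) (c : 'rV[L]_M),
    w = c *m map_mx iota B /\ forall tau, T tau -> B *m tau^T = 0.
Proof.
move=> hw; have [r [A [TA hA]]] := finite_subsystem T.
have kw : (w <= map_mx iota (kermx A^T))%MS.
  rewrite map_kermx; apply/sub_kermxP; apply/matrixP=> i j.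
  have /matrixP/(_ i 0) := hw _ (TA j); rewrite !mxE => e; rewrite -[RHS]e.
  by apply: eq_bigr => l _; rewrite !mxE.
have [c wE] := submxP kw.
exists (kermx A^T), c; split=> // tau /hA/submxP[D ->].
by rewrite trmx_mul mulmxA mulmx_ker mul0mx.
Qed.

End KernelDescent.

(** * Tensor coordinates for a form of projective space *)

Section Model.

Variables (p : nat).
Local Notation q := p.+2.
Implicit Types i j l : 'I_q.

(** The pair (f, j) stands for the j-th trace coordinate, with respect to the powers of
    xi, of the tensor coordinate f. The functions f fill whole orbits under f |-> f + i,
    so that the formulas are uniform in f. *)
Definition tensor_index := ({ffun 'I_q -> 'I_q} * 'I_q)%type.
Definition ambient_dim := #|{: tensor_index}|.-1.
Local Notation N := ambient_dim.

Lemma ambient_dimS : N.+1 = #|{: tensor_index}|.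
Proof. by rewrite prednK //; apply/card_gt0P; exists ([ffun=> 0], 0). Qed.

Definition tensor_of (s : 'I_N.+1) : tensor_index := enum_val (cast_ord ambient_dimS s).
Definition coord_of (z : tensor_index) : 'I_N.+1 :=
  cast_ord (esym ambient_dimS) (enum_rank z).

Lemma coord_ofK : cancel coord_of tensor_of.
Proof. by move=> z; rewrite /tensor_of /coord_of cast_ordKV enum_rankK. Qed.

Lemma tensor_ofK : cancel tensor_of coord_of.
Proof. by move=> s; rewrite /tensor_of /coord_of enum_valK cast_ordK. Qed.

Definition carry i j : nat := (q <= i + j)%N.

Lemma expr_carry (R : comNzRingType) (r t : R) i j : r ^+ q = t ->
  r ^+ i * r ^+ j = r ^+ (i + j)%R * t ^+ carry i j.
Proof.
move=> <-; rewrite -exprM -!exprD; congr (_ ^+ _); rewrite /= /carry.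
have lt := ltn_ord i; have lt' := ltn_ord j.
case: (leqP q (i + j)) => h; last by rewrite muln0 addn0 modn_small.
rewrite muln1 -[in LHS](subnK h); congr (_ + _)%N.
rewrite -{2}(subnK h) modnDr modn_small // ltn_subLR // -addnS.
by rewrite leq_add // ltnW.
Qed.

(** For v_l = u_l / r^l the powers of r combine into powers of t = r^q, because there
    are q factors and f m - (f m + i) = - i modulo q; what remains is the trace of xi^j
    times an element of K(xi). The locus of these vectors is therefore a K-form of
    projective space, embedded by q-fold tensors. *)
Definition phi (L : comNzRingType) (x r : L) (v : 'rV[L]_q) : 'rV[L]_N.+1 :=
  \row_s (\sum_i (x + res L i) ^+ (tensor_of s).2 *
           \prod_m (r ^+ (tensor_of s).1 m * v 0 ((tensor_of s).1 m + i))).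

Lemma phiE (L : comNzRingType) (x r : L) v f j :
  phi x r v 0 (coord_of (f, j)) =
  \sum_i (x + res L i) ^+ j * \prod_m (r ^+ f m * v 0 (f m + i)).
Proof. by rewrite mxE coord_ofK. Qed.

Lemma phiZ (L : comNzRingType) (x r : L) c v : phi x r (c *: v) = c ^+ q *: phi x r v.
Proof.
apply/rowP=> s; rewrite !mxE mulr_sumr; apply: eq_bigr => i _.
rewrite mulrCA; congr (_ * _).
rewrite -[in c ^+ _](card_ord q) -prodr_const -big_split /=.
by apply: eq_bigr => m _; rewrite mxE mulrCA.
Qed.

Lemma map_phi (L L' : comNzRingType) (f : {rmorphism L -> L'}) (x r : L) v s :
  f (phi x r v 0 s) = phi (f x) (f r) (map_mx f v) 0 s.
Proof.
rewrite !mxE rmorph_sum; apply: eq_bigr => i _.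
rewrite rmorphM rmorphXn rmorphD rmorph_prod /= (rmorph_res f); congr (_ * _).
by apply: eq_bigr => m _; rewrite rmorphM rmorphXn mxE.
Qed.

(** Replacing x by a conjugate permutes the entries of v cyclically: this is the descent
    datum. *)
Lemma phi_shift (L : comNzRingType) (chL : q \in [pchar L]) (x r : L) v l :
  phi (x + res L l) r v = phi x r (\row_i v 0 (i - l)).
Proof.
apply/rowP=> s; rewrite !mxE [RHS](reindex_inj (addrI l)) /=.
apply: eq_bigr => i _; rewrite resD // addrA; congr (_ * _).
by apply: eq_bigr => m _; rewrite mxE addrA addrAC addrK.
Qed.

Section Forms.

Variables (K : fieldType) (a t : K).

(** The coordinate z of phi at v_l = u_l / r^l, with an indeterminate in place of x. *)
Definition phiK (u : 'I_q -> K) (z : tensor_index) : {poly K} :=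
  \sum_i ('X + (res K i)%:P) ^+ z.2 *
    (t ^- i * \prod_m (t ^+ carry (z.1 m) i * u (z.1 m + i)))%:P.

(** The vectors v_l = u_l / r^l with u over K are dense in affine space, so vanishing on
    the image of phi can be tested on them; vanishing at the root xi and its conjugates
    is divisibility by the Artin-Schreier polynomial. In this way the forms are
    described over K alone. *)
Definition SB_forms (P : {mpoly K[N.+1]}) : Prop :=
  (exists d, P \is d.-homog) /\
  forall u, AS p a %| mmap polyC (fun s => phiK u (tensor_of s)) P.

Definition SB : proj_scheme K := @ProjScheme K N SB_forms (fun _ => @proj1 _ _).

Section OverClosure.

Variables (L : fieldType) (iota : {rmorphism K -> L}) (x r : L).
Hypotheses (chK : q \in [pchar K]) (t_nz : t != 0).
Hypotheses (xa : x ^+ q - x = iota a) (rt : r ^+ q = iota t).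

Let chL : q \in [pchar L]. Proof. by rewrite (fmorph_pchar iota). Qed.

Lemma r_nz : r != 0.
Proof.
apply/eqP=> r0; move/eqP: t_nz; apply.
by apply: (fmorph_inj iota); rewrite -rt r0 expr0n (rmorph0 iota).
Qed.

Definition twisted_vector (u : 'I_q -> K) : 'rV[L]_q := \row_i (iota (u i) / r ^+ i).

Lemma horner_phiK u s (y : L) :
  (map_poly iota (phiK u (tensor_of s))).[y] = phi y r (twisted_vector u) 0 s.
Proof.
rewrite /phiK rmorph_sum horner_sum mxE; apply: eq_bigr => i _.
rewrite rmorphM hornerM rmorphXn horner_exp rmorphD /= map_polyX !map_polyC !hornerE.
rewrite [X in (y + X) ^+ _ * iota _](rmorph_res iota); congr (_ * _).
rewrite rmorphM fmorphV rmorphXn rmorph_prod /= -rt.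
have -> : (r ^+ q) ^- i = \prod_(m < q) (r ^+ i)^-1.
  by rewrite prodr_const card_ord exprVn -!exprM mulnC.
rewrite -big_split /=; apply: eq_bigr => m _.
have nz l : r ^+ l != 0 by rewrite expf_neq0 // r_nz.
rewrite mxE rmorphM rmorphXn /=.
set f := (tensor_of s).1 m; have <- : r ^+ f * r ^+ i / r ^+ (f + i)%R = iota t ^+ carry f i.
  by rewrite (expr_carry _ _ rt) mulrAC divff ?mul1r.
by rewrite [r ^+ f * _]mulrC -!mulrA mulKf // [_^-1 * _]mulrC.
Qed.

End OverClosure.
End Forms.
End Model.

(** * Descent of forms vanishing on the image *)

Lemma modp_sumZ (F : fieldType) (I : finType) (c : I -> F) (G : I -> {poly F}) D :
  (\sum_i c i *: G i) %% D = \sum_i c i *: (G i %% D).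
Proof.
rewrite (big_morph (fun P => P %% D) (fun P Q => modpD D P Q) (mod0p D)).
by apply: eq_bigr => i _; rewrite modpZl.
Qed.

Section Descent.

Variables (p : nat).
Local Notation q := p.+2.
Local Notation N := (ambient_dim p).
Variables (K : fieldType) (a t : K) (L : fieldType).
Variables (iota : {rmorphism K -> L}) (x r : L).
Hypotheses (chK : q \in [pchar K]) (t_nz : t != 0).
Hypotheses (xa : x ^+ q - x = iota a) (rt : r ^+ q = iota t).
Implicit Types l : 'I_q.

Let chL : q \in [pchar L]. Proof. by rewrite (fmorph_pchar iota). Qed.

(** The hypothesis is a system of linear equations on the coefficients of P, one for
    each u and each coefficient of the remainder modulo the Artin-Schreier polynomial.
    The equations have coefficients in K, so kernel_descent applies. *)
Lemma form_descent (P : {mpoly L[N.+1]}) d : P \is d.-homog ->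
  (forall u l, mmap idfun (phi (x + res L l) r (twisted_vector iota r u) 0) P = 0) ->
  exists s : seq (L * {mpoly K[N.+1]}),
    (forall cg, cg \in s -> SB_forms a t cg.2) /\
    P = \sum_(cg <- s) cg.1 *: map_mpoly iota cg.2.
Proof.
move=> hP vanP; pose M := #|{: 'X_{1..N.+1 < d.+1}}|.
pose m_ (e : 'I_M) : 'X_{1..N.+1} := bmnm (enum_val e).
have sum_m (R : nmodType) (G : 'X_{1..N.+1} -> R) :
    \sum_(m : 'X_{1..N.+1 < d.+1}) G m = \sum_e G (m_ e).
  by rewrite (reindex _ (onW_bij _ (@enum_val_bij _))).
pose mon u (m : 'X_{1..N.+1}) := mmap1 (fun s => phiK t u (tensor_of s)) m %% AS p a.
(* The coordinate vectors force the solutions over K to be homogeneous of degree d. *)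
pose T (tau : 'rV[K]_M) :=
  (exists u (j : nat), forall e, tau 0 e = (mon u (m_ e))`_j) \/
  (exists2 e, mdeg (m_ e) != d & tau = delta_mx 0 e).
pose w : 'rV[L]_M := \row_e P@_(m_ e).
have sP : (msize P <= d.+1)%N.
  rewrite msizeE; apply/bigmax_leqP_seq=> m mP _.
  by rewrite ltnS (dhomog_mf hP mP).
have wT tau : T tau -> w *m (map_mx iota tau)^T = 0.
  case=> [[u [j tauE]] | [e de ->]]; apply/rowP=> z; rewrite !mxE.
    have dvd : AS p (iota a) %|
        mmap polyC (fun s => map_poly iota (phiK t u (tensor_of s))) P.
      apply: (introT (AS_dvdP chL _ xa)) => l; rewrite -horner_evalE rmorph_mmap.
      rewrite -[RHS](vanP u l); apply: eq_mmap => [c|s] /=.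
        by rewrite horner_evalE hornerC.
      by rewrite horner_evalE (horner_phiK t_nz rt).
    move: dvd; rewrite (mmapE d.+1) // => /modp_eq0P.
    rewrite (eq_bigr (fun m : 'X_{1..N.+1 < d.+1} =>
      P@_m *: map_poly iota (mmap1 (fun s => phiK t u (tensor_of s)) m))); last first.
      move=> m _; rewrite mul_polyC /mmap1 rmorph_prod.
      by congr (_ *: _); apply: eq_bigr => s _; rewrite rmorphXn.
    rewrite modp_sumZ -(map_AS _ iota) => /(congr1 (fun f : {poly L} => f`_j)).
    rewrite coef0 coef_sum => z0; rewrite -[RHS]z0 (sum_m _ (fun m =>
      (P@_m *: (map_poly iota (mmap1 (fun s => phiK t u (tensor_of s)) m) %%
                map_poly iota (AS p a)))`_j)).
    apply: eq_bigr => e _; rewrite !mxE ord1 tauE coefZ -map_modp coef_map.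
    by [].
  rewrite (bigD1 e) //= big1 => [|e' ne]; rewrite !mxE ?ord1 !eqxx.
    by rewrite (dhomog_nemf_coeff hP de) mul0r addr0.
  by rewrite (negPf ne) rmorph0 mulr0.
have [B [c [wE BT]]] := kernel_descent wT.
pose Q (i : 'I_M) : {mpoly K[N.+1]} := \sum_e B i e *: 'X_[m_ e].
have Qcoef (i : 'I_M) tau : T tau -> \sum_e B i e * tau 0 e = 0.
  move=> /BT/matrixP/(_ i 0); rewrite !mxE => e; rewrite -[RHS]e.
  by apply: eq_bigr => l _; rewrite mxE.
have Bdeg (i e : 'I_M) : mdeg (m_ e) != d -> B i e = 0.
  move=> de; have /Qcoef : T (delta_mx 0 e) by right; exists e.
  move=> /(_ i); rewrite (bigD1 e) //= big1 => [|e' ne]; rewrite !mxE !eqxx /=.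
    by rewrite mulr1 addr0.
  by rewrite (negPf ne) mulr0.
exists [seq (c 0 i, Q i) | i <- enum 'I_M]; split=> [_ /mapP[i _ ->] /=|].
  split=> [|u].
    exists d; apply: rpred_sum => e _; have [de|de] := eqVneq (mdeg (m_ e)) d.
      by rewrite rpredZ // dhomogX; apply/eqP.
    by rewrite Bdeg // scale0r rpred0.
  rewrite /Q rmorph_sum /=.
  rewrite (eq_bigr (fun e => B i e *: mmap1 (fun s => phiK t u (tensor_of s)) (m_ e))).
    apply/modp_eq0P; rewrite modp_sumZ; apply/polyP=> j.
    rewrite coef_sum coef0 -[RHS](Qcoef i (\row_e (mon u (m_ e))`_j)).
      by apply: eq_bigr => e _; rewrite coefZ mxE.
    by left; exists u, j => e; rewrite mxE.
  by move=> e _; rewrite mmapZ mmapX mul_polyC.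
rewrite big_map big_enum /= {1}(mpolywE sP).
rewrite (sum_m _ (fun m => P@_m *: 'X_[m])).
transitivity (\sum_e \sum_i (c 0 i * iota (B i e)) *: ('X_[m_ e] : {mpoly L[N.+1]})).
  apply: eq_bigr => e _; rewrite -scaler_suml; congr (_ *: _).
  have /rowP/(_ e) := wE; rewrite !mxE => ->.
  by apply: eq_bigr => i _; rewrite mxE.
rewrite exchange_big; apply: eq_bigr => i _ /=.
rewrite rmorph_sum scaler_sumr; apply: eq_bigr => e _ /=.
by rewrite map_mpolyZ map_mpolyX scalerA.
Qed.

End Descent.

(** * Points of the scheme *)

Section Homogeneous.

Variables (n : nat) (R : comNzRingType).

Lemma homogXU (s : 'I_n) : ('X_s : {mpoly R[n]}) \is 1.-homog.
Proof. by rewrite dhomogX /= mdeg1. Qed.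

Lemma mmap_XU (S : comNzRingType) (f : {rmorphism R -> S}) (h : 'I_n -> S) s :
  mmap f h 'X_s = h s.
Proof. by rewrite mmapX mmap1U. Qed.

Lemma prod_homog1 k (F : 'I_k -> {mpoly R[n]}) :
  (forall m, F m \is 1.-homog) -> \prod_m F m \is k.-homog.
Proof.
elim: k F => [|k IH] F hF; first by rewrite big_ord0 dhomog1.
by rewrite big_ord_recl; apply: (@dhomogM _ _ _ 1 _ k); [apply: hF | apply: IH].
Qed.

End Homogeneous.

Section PointsOfModel.

Variables (p : nat).
Local Notation q := p.+2.
Local Notation N := (ambient_dim p).
Variables (K : fieldType) (a t : K) (L : fieldType).
Variables (iota : {rmorphism K -> L}) (x r : L).
Hypotheses (chK : q \in [pchar K]) (t_nz : t != 0).
Hypotheses (xa : x ^+ q - x = iota a) (rt : r ^+ q = iota t).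
Implicit Types l : 'I_q.

Let chL : q \in [pchar L]. Proof. by rewrite (fmorph_pchar iota). Qed.

Hypothesis K_infinite : forall n, exists s : seq K, uniq s /\ (n < size s)%N.

Lemma poly_eq0_on_K (G : {poly L}) c : c != 0 ->
  (forall b, G.[iota b * c] = 0) -> G = 0.
Proof.
move=> c_nz G0; apply/eqP/negPn/negP => G_nz; have [s [Us]] := K_infinite (size G).
apply/negP; rewrite -leqNgt ltnW // -(size_map (fun b => iota b * c) s).
apply: max_poly_roots => //; first by apply/allP => _ /mapP[b _ ->]; apply/rootP.
by rewrite map_inj_uniq // => b b' /(mulIf c_nz)/fmorph_inj.
Qed.

(** The entries of v are freed one at a time: as long as one entry runs through the
    K-multiples of a fixed element, the value is a polynomial in it with infinitely many
    zeros. *)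
Lemma phi_in_SB (P : {mpoly K[N.+1]}) v : SB_forms a t P -> eval_at iota P (phi x r v) = 0.
Proof.
move=> [_ hP]; pose Kr n (v : 'rV[L]_q) :=
  forall i : 'I_q, (n <= i)%N -> exists b, v 0 i = iota b / r ^+ i.
suff H n : (n <= q)%N -> forall v, Kr n v -> eval_at iota P (phi x r v) = 0.
  by apply: (H q) => // i; rewrite leqNgt ltn_ord.
elim: n => [_ {}v Kv|n IH nq {}v Kv].
  have [u uE] := fin_all_exists (fun i => Kv i isT).
  have /(AS_dvd_map chK _ xa)/(_ 0) := hP u.
  rewrite res0 addr0 -horner_evalE !rmorph_mmap => <-.
  rewrite eval_atE; apply: eq_mmap => [b|s] /=; rewrite horner_evalE.
    by rewrite map_polyC hornerC.
  rewrite (horner_phiK t_nz rt); congr (phi _ _ _ _ _).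
  by apply/rowP=> i; rewrite uE mxE.
(* vX is v with an indeterminate as the entry that is being freed. *)
pose i0 := Ordinal nq.
pose vX : 'rV[{poly L}]_q := \row_i (if i == i0 then 'X else (v 0 i)%:P).
pose G := mmap (polyC \o iota) (phi x%:P r%:P vX 0) P.
have GE c : G.[c] = eval_at iota P (phi x r (\row_i (if i == i0 then c else v 0 i))).
  rewrite -horner_evalE /G rmorph_mmap eval_atE; apply: eq_mmap => [b|s] /=.
    by rewrite horner_evalE hornerC.
  rewrite map_phi; congr (phi _ _ _ _ _); try exact: hornerC.
  apply/rowP=> i; rewrite !mxE /= horner_evalE.
  by case: ifP => _; rewrite ?hornerX ?hornerC.
have r_nz : (r ^+ i0)^-1 != 0 by rewrite invr_neq0 // expf_neq0 // (r_nz t_nz rt).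
have /(congr1 (horner^~ (v 0 i0))) : G = 0.
  apply: (poly_eq0_on_K r_nz) => b; rewrite GE; apply: (IH (ltnW nq)) => i ni; rewrite mxE.
  case: eqP => [->|/eqP ne]; first by exists b.
  by apply: Kv; rewrite ltn_neqAle ni andbT eq_sym -val_eqE in ne *.
rewrite /= GE horner0 => e; rewrite -[RHS]e; congr (eval_at _ _ (phi _ _ _)).
by apply/rowP=> i; rewrite mxE; case: eqP => [->|].
Qed.

(** A vector killed by the forms over K is killed by every form over L that vanishes on
    the image of phi, although such a form need not be invariant under conjugation. *)
Lemma SB_vanish (P : {mpoly L[N.+1]}) d (y : 'rV[L]_N.+1) : P \is d.-homog ->
  (forall v : 'rV_q, mmap idfun (phi x r v 0) P = 0) ->
  (forall Q : {mpoly K[N.+1]}, SB_forms a t Q -> eval_at iota Q y = 0) ->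
  mmap idfun (y 0) P = 0.
Proof.
move=> hP vanP yX.
have [u l|s [sX ->]] := form_descent chK t_nz xa rt hP; first by rewrite phi_shift.
rewrite raddf_sum big_seq big1 // => cg /sX/yX; rewrite eval_atE /= mmapZ => e.
rewrite mmap_map_mpoly -[X in _ * X]/(mmap iota (y 0) cg.2).
by rewrite e mulr0.
Qed.

Implicit Types (f : {ffun 'I_q -> 'I_q}).

Definition weight f : L := \prod_m r ^+ f m.

Lemma weight_nz f : weight f != 0.
Proof. by apply/prodf_neq0=> m _; rewrite expf_neq0 // (r_nz t_nz rt). Qed.

Lemma phi_weight v f (j : 'I_q) : phi x r v 0 (coord_of (f, j)) =
  weight f * \sum_i (x + res L i) ^+ j * \prod_m v 0 (f m + i).
Proof.
rewrite phiE mulr_sumr; apply: eq_bigr => i _.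
by rewrite mulrCA big_split.
Qed.

(** The linear form over L that recovers the product of the v_(f m) from phi v, by
    trace_dual. *)
Definition Zform f : {mpoly L[N.+1]} :=
  (weight f)^-1 *: ('X_(coord_of (f, 0)) - \sum_(j : 'I_q) x ^+ j *: 'X_(coord_of (f, rev_ord j))).

Definition Zval f (y : 'rV[L]_N.+1) : L :=
  (weight f)^-1 * (y 0 (coord_of (f, 0)) - \sum_(j : 'I_q) x ^+ j * y 0 (coord_of (f, rev_ord j))).

Lemma Zform_homog f : Zform f \is 1.-homog.
Proof.
rewrite rpredZ // rpredB ?homogXU // rpred_sum // => j _.
by rewrite rpredZ ?homogXU.
Qed.

Lemma Zform_eval f (y : 'rV[L]_N.+1) : mmap idfun (y 0) (Zform f) = Zval f y.
Proof.
rewrite mmapZ rmorphB rmorph_sum /= mmap_XU; congr (_ * (_ - _)).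
by apply: eq_bigr => j _; rewrite mmapZ mmap_XU.
Qed.

Lemma ZvalZ f c y : Zval f (c *: y) = c * Zval f y.
Proof.
rewrite /Zval mulrCA; congr (_ * _); rewrite mulrBr mxE mulr_sumr.
by congr (_ - _); apply: eq_bigr => j _; rewrite mxE mulrCA.
Qed.

Lemma Zval_phi f v : Zval f (phi x r v) = \prod_m v 0 (f m).
Proof.
pose c i := weight f * \prod_m v 0 (f m + i).
have := @trace_dual p L chL x c (fun j => phi x r v 0 (coord_of (f, j))) 0.
rewrite res0 addr0 => e; apply: (mulfI (weight_nz f)).
rewrite /Zval mulrA divff ?weight_nz // mul1r.
rewrite (eq_bigr (fun j => phi x r v 0 (coord_of (f, rev_ord j)) * x ^+ j)); last first.
  by move=> j _; rewrite mulrC.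
rewrite e /c; last first.
  by move=> j; rewrite phi_weight mulr_sumr; apply: eq_bigr => i _; rewrite mulrCA.
by congr (_ * _); apply: eq_bigr => m _; rewrite addr0.
Qed.

Definition const_index c : {ffun 'I_q -> 'I_q} := [ffun=> c].
Definition hook_index c (l : 'I_q) : {ffun 'I_q -> 'I_q} := [ffun m => if m == 0 then l else c].
Definition translate_index f i : {ffun 'I_q -> 'I_q} := [ffun m => f m + i].

Lemma Zval_const c v : Zval (const_index c) (phi x r v) = v 0 c ^+ q.
Proof.
rewrite Zval_phi (eq_bigr (fun=> v 0 c)); first by rewrite prodr_const card_ord.
by move=> m _; rewrite ffunE.
Qed.

Lemma Zval_hook c l v : Zval (hook_index c l) (phi x r v) = v 0 c ^+ p.+1 * v 0 l.
Proof.
rewrite Zval_phi big_ord_recl ffunE /= mulrC (eq_bigr (fun=> v 0 c)).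
  by rewrite prodr_const card_ord.
by move=> m _; rewrite ffunE.
Qed.

Section KilledByForms.

Variable y : 'rV[L]_N.+1.
Hypothesis yX : forall Q : {mpoly K[N.+1]}, SB_forms a t Q -> eval_at iota Q y = 0.

(** This relation and the two after it hold on the image of phi by inspection, hence
    wherever the forms over K vanish. Together they reconstruct a preimage under phi. *)
Lemma Zval_pow f : Zval f y ^+ q = \prod_m Zval (const_index (f m)) y.
Proof.
apply/eqP; rewrite -subr_eq0; apply/eqP.
rewrite -[RHS](@SB_vanish
    (Zform f ^+ q - \prod_m Zform (const_index (f m))) q y) //.
- rewrite rmorphB rmorphXn rmorph_prod /= Zform_eval; congr (_ - _).
  by apply: eq_bigr => m _; rewrite Zform_eval.
- rewrite rpredB ?prod_homog1 // => [|m]; last exact: Zform_homog.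
  by have := dhomogMn q (Zform_homog f); rewrite mul1n.
move=> v; rewrite rmorphB rmorphXn rmorph_prod /= Zform_eval Zval_phi.
rewrite -prodrXl; apply/eqP; rewrite subr_eq0; apply/eqP; apply: eq_bigr => m _.
by rewrite Zform_eval Zval_const.
Qed.

Lemma Zval_chart f c :
  Zval (const_index c) y ^+ p.+1 * Zval f y = \prod_m Zval (hook_index c (f m)) y.
Proof.
apply/eqP; rewrite -subr_eq0; apply/eqP.
rewrite -[RHS](@SB_vanish
    (Zform (const_index c) ^+ p.+1 * Zform f - \prod_m Zform (hook_index c (f m))) q y) //.
- rewrite rmorphB rmorphM rmorphXn rmorph_prod /= !Zform_eval; congr (_ - _).
  by apply: eq_bigr => m _; rewrite Zform_eval.
- rewrite rpredB ?prod_homog1 // => [|m]; last exact: Zform_homog.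
  have := dhomogM (dhomogMn p.+1 (Zform_homog (const_index c))) (Zform_homog f).
  by rewrite mul1n addn1.
move=> v; rewrite rmorphB rmorphM rmorphXn rmorph_prod /= !Zform_eval Zval_const Zval_phi.
apply/eqP; rewrite subr_eq0; apply/eqP.
have -> : v 0 c ^+ q ^+ p.+1 = \prod_(m < q) v 0 c ^+ p.+1.
  by rewrite prodr_const card_ord -!exprM mulnC.
rewrite -big_split.
by apply: eq_bigr => m _; rewrite Zform_eval Zval_hook.
Qed.

Lemma coord_Zval f (j : 'I_q) : y 0 (coord_of (f, j)) =
  weight f * \sum_i (x + res L i) ^+ j * Zval (translate_index f i) y.
Proof.
apply/eqP; rewrite -subr_eq0; apply/eqP.
rewrite -[RHS](@SB_vanish ('X_(coord_of (f, j)) -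
    weight f *: \sum_i (x + res L i) ^+ j *: Zform (translate_index f i)) 1 y) //.
- rewrite rmorphB /= mmapZ rmorph_sum /= mmap_XU; congr (_ - _ * _).
  by apply: eq_bigr => i _; rewrite mmapZ Zform_eval.
- rewrite rpredB ?homogXU // rpredZ // rpred_sum // => i _.
  by rewrite rpredZ // Zform_homog.
move=> v; rewrite rmorphB /= mmapZ rmorph_sum /= mmap_XU phi_weight.
apply/eqP; rewrite subr_eq0; apply/eqP; congr (_ * _).
apply: eq_bigr => i _; rewrite mmapZ Zform_eval Zval_phi; congr (_ * _).
by apply: eq_bigr => m _; rewrite ffunE.
Qed.

(** Some tensor coordinate is nonzero, and by Zval_pow its q-th power is a product of
    coordinates v_c^q. *)
Lemma SB_point : y != 0 -> exists c, Zval (const_index c) y != 0.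
Proof.
move=> /rV0Pn[s ys].
have [[f j] sE] : exists z, s = coord_of z by exists (tensor_of s); rewrite tensor_ofK.
have [i Zi] : exists i, Zval (translate_index f i) y != 0.
  apply/existsP; rewrite -negb_forall; apply: contra ys => /forallP Z0.
  rewrite sE coord_Zval big1 ?mulr0 // => i _.
  by rewrite (eqP (Z0 i)) mulr0.
move: (expf_neq0 q Zi); rewrite Zval_pow => /prodf_neq0 h.
by exists (translate_index f i 0); apply: h.
Qed.

(** On phi v this is v multiplied by v_c^(q-1). *)
Definition chart c : 'rV[L]_q := \row_l Zval (hook_index c l) y.

Lemma phi_chart c : phi x r (chart c) = Zval (const_index c) y ^+ p.+1 *: y.
Proof.
apply/rowP=> s; rewrite -[s]tensor_ofK; case: (tensor_of s) => f j.
rewrite phi_weight mxE coord_Zval mulrCA; congr (_ * _); rewrite mulr_sumr.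
apply: eq_bigr => i _; rewrite mulrCA Zval_chart; congr (_ * _).
by apply: eq_bigr => m _; rewrite mxE ffunE.
Qed.

Lemma chart_nz c : Zval (const_index c) y != 0 -> chart c != 0.
Proof.
move=> nz; apply/rV0Pn; exists c; rewrite !mxE.
rewrite (_ : hook_index c c = const_index c) //.
by apply/ffunP=> m; rewrite !ffunE; case: ifP.
Qed.

End KilledByForms.

End PointsOfModel.

(** * Homogeneous coordinates *)

Section Points.

Variables (F : fieldType) (n : nat).
Implicit Types (P : proj_point F n) (v : 'rV[F]_n.+1).

Lemma const1_nz : const_mx 1 != 0 :> 'rV[F]_n.+1.
Proof. by apply/rV0Pn; exists 0; rewrite !mxE oner_neq0. Qed.

Definition pt v : proj_point F n :=
  (\pi_(proj_point F n)
     (insubd (exist (fun u => u != 0) _ const1_nz : {u : 'rV[F]_n.+1 | u != 0}) v))%qT.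

Lemma coords_nz P : coords P != 0.
Proof. by rewrite /coords; case: (repr P). Qed.

Lemma proportionalP (u v : 'rV[F]_n.+1) : u != 0 -> v != 0 ->
  reflect (exists2 c, c != 0 & v = c *: u) (u == v)%MS.
Proof.
move=> u_nz v_nz; apply: (iffP andP) => [[_ /sub_rVP[c vE]]|[c c_nz ->]].
  exists c => //; apply: contraNneq v_nz => c0.
  by rewrite vE c0 scale0r.
by split; [rewrite eqmx_scale | rewrite scalemx_sub].
Qed.

Lemma has_coordsP P v :
  has_coords P v <-> v != 0 /\ exists2 c, c != 0 & v = c *: coords P.
Proof.
by split=> -[v_nz h]; split=> //; apply/(proportionalP (coords_nz P) v_nz).
Qed.

Lemma has_coords_coords P : has_coords P (coords P).
Proof. by split; rewrite ?coords_nz ?submx_refl. Qed.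

Lemma has_coordsZ P v c : c != 0 -> has_coords P v -> has_coords P (c *: v).
Proof.
move=> c_nz /has_coordsP[v_nz [b b_nz vE]]; apply/has_coordsP.
split; first by rewrite scaler_eq0 negb_or c_nz.
by exists (c * b); rewrite ?mulf_neq0 // vE scalerA.
Qed.

Lemma has_coords_pt v : v != 0 -> has_coords (pt v) v.
Proof.
move=> v_nz; split=> //; rewrite /coords.
have /eqmodP : pt v = (\pi_(proj_point F n) (repr (pt v)))%qT by rewrite reprK.
by rewrite /= /proportional val_insubd v_nz /= andbC.
Qed.

Lemma has_coords_inj P P' v : has_coords P v -> has_coords P' v -> P = P'.
Proof.
move=> [_ /eqmxP e] [_ /eqmxP e']; rewrite -[P]reprK -[P']reprK; apply/eqmodP.
by rewrite /= /proportional; apply/eqmxP; apply: eqmx_trans e _; apply: eqmx_sym.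
Qed.

Lemma has_coords_proportional P v w : has_coords P v -> has_coords P w ->
  exists2 c, c != 0 & w = c *: v.
Proof.
move=> /has_coordsP[_ [c c_nz ->]] /has_coordsP[_ [d d_nz ->]].
exists (d / c); first by rewrite mulf_neq0 ?invr_neq0.
by rewrite scalerA divfK.
Qed.

End Points.

Lemma point_of_coords (F L : fieldType) (iota : {rmorphism F -> L}) (X : proj_scheme F)
    (P : proj_point L (ambient X)) v : has_coords P v ->
  point_of iota P <-> forall Q, forms Q -> eval_at iota Q v = 0.
Proof.
move=> /has_coordsP[v_nz [c c_nz vE]]; split=> PX Q QX.
  by have [d hQ] := forms_homog QX; rewrite vE (eval_at_homog _ _ _ hQ) PX // mulr0.
have [d hQ] := forms_homog QX; have := PX Q QX.
rewrite vE (eval_at_homog _ _ _ hQ) => /eqP; rewrite mulf_eq0 expf_eq0.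
by rewrite (negPf c_nz) andbF => /eqP.
Qed.

Lemma point_of_base_change (F L : fieldType) (iota : {rmorphism F -> L}) (X : proj_scheme F)
    (P : proj_point L (ambient X)) :
  point_of idfun (X := base_change iota X) P <-> point_of iota P.
Proof.
split=> PX Q QX.
  have /PX : @forms _ (base_change iota X) (map_mpoly iota Q) by exists Q.
  by rewrite !eval_atE mmap_map_mpoly.
have [Q0 Q0X ->] := QX; rewrite -[RHS](PX Q0 Q0X) !eval_atE.
by rewrite mmap_map_mpoly.
Qed.

(** * The scheme is a Severi-Brauer variety *)

Section SeveriBrauer.

Variables (p : nat).
Local Notation q := p.+2.
Local Notation N := (ambient_dim p).
Variables (K : fieldType) (a t : K) (L : closedFieldType).
Variables (iota : {rmorphism K -> L}) (x r : L).
Hypotheses (chK : q \in [pchar K]) (t_nz : t != 0).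
Hypotheses (xa : x ^+ q - x = iota a) (rt : r ^+ q = iota t).
Implicit Types l : 'I_q.

Let chL : q \in [pchar L]. Proof. by rewrite (fmorph_pchar iota). Qed.

Hypothesis K_infinite : forall n, exists s : seq K, uniq s /\ (n < size s)%N.
Local Notation X := (SB p a t).
Local Notation Phi := (phi x r).

Lemma Phi_nz (v : 'rV[L]_q) : v != 0 -> Phi v != 0.
Proof.
move=> /rV0Pn[c vc]; apply: contra_neq (expf_neq0 q vc) => P0.
by rewrite -(Zval_const x chK t_nz rt) P0 -[0](scale0r 0) ZvalZ mul0r.
Qed.

Lemma point_Phi (P : proj_point L N) (v : 'rV[L]_q) : has_coords P (Phi v) ->
  point_of (X := X) iota P.
Proof.
move=> Pv; apply/(point_of_coords (X := X) iota Pv) => Q QX.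
exact: (phi_in_SB chK t_nz xa rt K_infinite).
Qed.

Lemma chart_proportional (P : proj_point L N) (v : 'rV[L]_q) c : has_coords P (Phi v) ->
  exists2 b, b != 0 & chart x r (coords P) c = (b * v 0 c ^+ p.+1) *: v.
Proof.
move=> Pv; have [b b_nz bE] := has_coords_proportional Pv (has_coords_coords P).
exists b => //; apply/rowP=> l; rewrite !mxE bE ZvalZ.
by rewrite (Zval_hook x chK t_nz rt) mulrA.
Qed.

Lemma Zval_const_nz (P : proj_point L N) (v : 'rV[L]_q) c : has_coords P (Phi v) ->
  (Zval x r (const_index c) (coords P) != 0) = (v 0 c != 0).
Proof.
move=> Pv; have [b b_nz bE] := has_coords_proportional Pv (has_coords_coords P).
by rewrite bE ZvalZ (Zval_const x chK t_nz rt) mulf_eq0 (negPf b_nz) expf_eq0.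
Qed.

Lemma point_chart (P : proj_point L N) c : point_of (X := X) iota P ->
  Zval x r (const_index c) (coords P) != 0 ->
  [/\ chart x r (coords P) c != 0 & has_coords P (Phi (chart x r (coords P) c))].
Proof.
move=> PX nz; split; first exact: chart_nz.
rewrite (phi_chart chK t_nz xa rt PX).
by apply: has_coordsZ (has_coords_coords P); apply: expf_neq0.
Qed.

Lemma point_exists_chart (P : proj_point L N) : point_of (X := X) iota P ->
  exists c, Zval x r (const_index c) (coords P) != 0.
Proof. by move=> PX; apply: (SB_point chK t_nz xa rt PX) (coords_nz P). Qed.

Lemma point_Phi_ex (P : proj_point L N) : point_of (X := X) iota P ->
  exists2 v, v != 0 & has_coords P (Phi v).
Proof.
move=> PX; have [c nz] := point_exists_chart PX.
by have [] := point_chart PX nz; exists (chart x r (coords P) c).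
Qed.

(** Both vectors are recovered up to scalars from the chart at a nonzero entry of the
    first. *)
Lemma Phi_inj (P : proj_point L N) (v w : 'rV[L]_q) : v != 0 -> w != 0 ->
  has_coords P (Phi v) -> has_coords P (Phi w) -> exists2 c, c != 0 & w = c *: v.
Proof.
move=> /rV0Pn[c vc] w_nz Pv Pw.
have wc : w 0 c != 0 by rewrite -(Zval_const_nz c Pw) (Zval_const_nz c Pv).
have [b b_nz bE] := chart_proportional c Pv.
have [d d_nz] := chart_proportional c Pw; rewrite bE => e.
have dw_nz : d * w 0 c ^+ p.+1 != 0 by rewrite mulf_neq0 // expf_neq0.
exists ((d * w 0 c ^+ p.+1)^-1 * (b * v 0 c ^+ p.+1)).
  by rewrite mulf_neq0 ?invr_neq0 ?mulf_neq0 ?expf_neq0.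
by rewrite -scalerA e scalerA mulVf // scale1r.
Qed.

(** A form vanishing at the points of the scheme vanishes on the image of phi, and
    form_descent writes it in terms of forms over K. *)
Lemma reduced_SB : reduced (base_change iota X).
Proof.
move=> d P hP vanP.
have Pphi (v : 'rV[L]_q) : eval_at idfun P (Phi v) = 0.
  have nzP (w : 'rV[L]_q) : w != 0 -> eval_at idfun P (Phi w) = 0.
    move=> /Phi_nz/has_coords_pt hw.
    have PX := (point_of_base_change (X := X) iota (pt (Phi w))).2 (point_Phi hw).
    have /has_coordsP[_ [c _ ->]] := hw.
    by rewrite (eval_at_homog _ _ _ hP) (vanP _ PX) mulr0.
  have [->|/nzP//] := eqVneq v 0.
  (* The zero vector is the multiple by 0 of a nonzero one; this covers forms of degree
     0. *)
  have -> : 0 = 0 *: const_mx 1 :> 'rV[L]_q by rewrite scale0r.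
  by rewrite phiZ (eval_at_homog _ _ _ hP) nzP ?const1_nz // mulr0.
have [u l|s [sX PE]] := form_descent chK t_nz xa rt hP.
  rewrite phi_shift //; have := Pphi (\row_i twisted_vector iota r u 0 (i - l)).
  by rewrite eval_atE.
exists [seq (cg.1%:MP, map_mpoly iota cg.2) | cg <- s]; split.
  by move=> _ /mapP[cg cgs ->]; exists cg.2; rewrite //=; apply: sX.
by rewrite big_map PE; apply: eq_bigr => cg _; rewrite mul_mpolyC.
Qed.

Definition to_proj (P : proj_point L N) : proj_point L p.+1 :=
  pt (chart x r (coords P) (odflt 0 [pick c | Zval x r (const_index c) (coords P) != 0])).

Definition of_proj (P : proj_point L p.+1) : proj_point L N := pt (Phi (coords P)).

Lemma to_projE (P : proj_point L N) (v : 'rV[L]_q) : v != 0 -> has_coords P (Phi v) ->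
  has_coords (to_proj P) v.
Proof.
move=> v_nz Pv; have PX := point_Phi Pv; rewrite /to_proj; case: pickP => [c nz|no].
  have [ch_nz Pch] := point_chart PX nz.
  have [b b_nz ->] := Phi_inj ch_nz v_nz Pch Pv.
  by apply: has_coordsZ => //; apply: has_coords_pt.
by have [c] := point_exists_chart PX; rewrite no.
Qed.

Lemma of_projE (P : proj_point L p.+1) : has_coords (of_proj P) (Phi (coords P)).
Proof. by apply/has_coords_pt/Phi_nz/coords_nz. Qed.

Definition Phi_forms (s : 'I_N.+1) : {mpoly L[q]} :=
  \sum_i (x + res L i) ^+ (tensor_of s).2 *:
     \prod_m (r ^+ (tensor_of s).1 m *: 'X_((tensor_of s).1 m + i)).

Lemma Phi_forms_homog s : Phi_forms s \is q.-homog.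
Proof.
apply: rpred_sum => i _; apply: rpredZ; apply: prod_homog1 => m.
by apply: rpredZ; apply: homogXU.
Qed.

Lemma Phi_forms_eval (v : 'rV[L]_q) : \row_s eval_at idfun (Phi_forms s) v = Phi v.
Proof.
apply/rowP=> s; rewrite !mxE eval_atE rmorph_sum; apply: eq_bigr => i _ /=.
rewrite mmapZ rmorph_prod; congr (_ * _); apply: eq_bigr => m _ /=.
by rewrite mmapZ mmap_XU.
Qed.

(** The map phi has degree q, and near a point with v_c <> 0 its inverse is the linear
    map given by the chart at c. *)
Lemma isomorphic_SB : isomorphic idfun (base_change iota X) (proj_space L p.+1).
Proof.
exists to_proj; split.
  split=> [P _ Q []|P /point_of_base_change PX]; have [c nz] := point_exists_chart PX.
  exists 1%N, (fun l => Zform x r (hook_index c l)).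
  have hvE Q : (\row_l eval_at idfun (Zform x r (hook_index c l)) (coords Q)) =
      chart x r (coords Q) c.
    by apply/rowP=> l; rewrite !mxE eval_atE Zform_eval.
  split=> [l||Q /point_of_base_change QX]; first exact: Zform_homog.
    by rewrite hvE; have [] := point_chart PX nz.
  rewrite hvE => ch_nz; have [v v_nz Qv] := point_Phi_ex QX.
  have [b b_nz chE] := chart_proportional c Qv.
  move: ch_nz; rewrite chE scaler_eq0 negb_or => /andP[bv_nz _].
  by apply: has_coordsZ => //; apply: to_projE.
exists of_proj; last first.
  split=> [P /point_of_base_change PX|P _].
    have [v v_nz Pv] := point_Phi_ex PX; have tv := to_projE v_nz Pv.
    have [_ [c c_nz vE]] := (has_coordsP _ _).1 tv.
    apply: has_coords_inj (of_projE _) _; move: Pv; rewrite vE phiZ.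
    move/(has_coordsZ (invr_neq0 (expf_neq0 q c_nz))).
    by rewrite scalerA mulVf ?scale1r // expf_neq0.
  exact: has_coords_inj (to_projE (coords_nz P) (of_projE P)) (has_coords_coords P).
split=> [P _|P _].
  by apply/point_of_base_change/(point_Phi (of_projE P)).
exists q, Phi_forms; split=> [s||Q _ _]; first exact: Phi_forms_homog.
  by rewrite Phi_forms_eval Phi_nz // coords_nz.
by rewrite Phi_forms_eval; apply: of_projE.
Qed.

Theorem SB_Severi_Brauer : Severi_Brauer iota p.+1 X.
Proof. by split; [apply: reduced_SB | apply: isomorphic_SB]. Qed.

End SeveriBrauer.

(** * Automorphisms from the cyclic algebra *)

Lemma all_eigen_scalar (F : fieldType) n (A : 'M[F]_n.+1) :
  (forall v : 'rV_n.+1, v != 0 -> exists c, v *m A = c *: v) -> exists c, A = c%:M.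
Proof.
move=> eigA; pose d i : 'rV[F]_n.+1 := delta_mx 0 i.
have d_nz i : d i != 0 by apply/rV0Pn; exists i; rewrite mxE !eqxx oner_neq0.
have off i j : i != j -> A i j = 0.
  move=> ij; have [c /rowP/(_ j)] := eigA _ (d_nz i).
  by rewrite -rowE !mxE eqxx [j == i]eq_sym (negPf ij) mulr0.
exists (A 0 0); apply/matrixP=> i j; rewrite !mxE.
have [<-|ij] := eqVneq i j; last by rewrite mulr0n off.
rewrite mulr1n; have [->//|i0] := eqVneq i 0.
have [|c /rowP eA] := eigA (d 0 + d i).
  apply/rV0Pn; exists 0; rewrite !mxE !eqxx [0 == i]eq_sym (negPf i0) /= addr0.
  exact: oner_neq0.
have := eA 0; have := eA i; rewrite mulmxDl -!rowE !mxE !eqxx [0 == i]eq_sym (negPf i0) /=.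
rewrite off 1?eq_sym // (off i 0) // !(add0r, addr0) mulr1 => -> ->.
by [].
Qed.

Section Automorphisms.

Variables (p : nat).
Local Notation q := p.+2.
Local Notation N := (ambient_dim p).
Variables (K : fieldType) (a t : K) (L : closedFieldType).
Variables (iota : {rmorphism K -> L}) (x r : L).
Hypotheses (chK : q \in [pchar K]) (t_nz : t != 0).
Hypotheses (xa : x ^+ q - x = iota a) (rt : r ^+ q = iota t).
Implicit Types l : 'I_q.

Let chL : q \in [pchar L]. Proof. by rewrite (fmorph_pchar iota). Qed.

Hypothesis K_infinite : forall n, exists s : seq K, uniq s /\ (n < size s)%N.
Local Notation X := (SB p a t).
Local Notation Phi := (phi x r).
Implicit Types e : 'I_q -> {poly K}.

(** The matrix of the element sum_s e_s(xi) u^s of the cyclic algebra, where xi acts by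
    diag(x + i) and u by r times the cyclic shift of coordinates; indeed u^q = t and u
    xi u^-1 = xi + 1 for these matrices. *)
Definition alg_mx e : 'M[L]_q :=
  \matrix_(i, l) (r ^+ (l - i)%R * (map_poly iota (e (l - i))).[x + res L i]).

Definition alg_poly e (g h : {ffun 'I_q -> 'I_q}) (j : 'I_q) : {poly K} :=
  'X^j * \prod_m (e (h m - g m) \Po ('X + (res K (g m))%:P)).

(** The matrix over K of the map induced on tensors: up to powers of t, the value of
    alg_poly at x + i is the coefficient of the tensor h + i in the trace coordinate (g,
    j) of the image. *)
Definition alg_lift e : 'M[K]_N.+1 := \matrix_(s, s')
  ((\prod_m t ^+ carry ((tensor_of s).1 m) ((tensor_of s').1 m - (tensor_of s).1 m)) *
   (alg_poly e (tensor_of s).1 (tensor_of s').1 (tensor_of s).2 %% AS p a)`_(tensor_of s').2).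

Lemma horner_modAS (P : {poly K}) l :
  (map_poly iota P).[x + res L l] = \sum_(j < q) iota (P %% AS p a)`_j * (x + res L l) ^+ j.
Proof.
have sz : (size (map_poly iota (P %% AS p a)) <= q)%N.
  by rewrite size_map_poly -ltnS -(size_AS p a) ltn_modp -size_poly_eq0 size_AS.
rewrite {1}(divp_eq P (AS p a)) rmorphD rmorphM /= map_AS hornerD hornerM.
rewrite (rootP (root_AS chL l xa)) mulr0 add0r (horner_coef_wide _ sz).
by apply: eq_bigr => j _; rewrite coef_map.
Qed.

(** Expanding the q-fold product over all functions h, the powers of r collect into
    powers of t, and the tensor h at the conjugate x + i is multiplied by a polynomial
    over K in x + i. The remainder of this polynomial modulo the Artin-Schreier
    polynomial expresses the sum over i by trace coordinates. *)
Lemma phi_alg_mx e v : Phi (v *m (alg_mx e)^T) = Phi v *m (map_mx iota (alg_lift e))^T.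
Proof.
apply/rowP=> s; rewrite mxE [RHS]mxE.
rewrite (reindex (@coord_of p)) /=; last first.
  by apply: onW_bij; exists (@tensor_of p); [apply: coord_ofK | apply: tensor_ofK].
under [RHS]eq_bigr do rewrite !mxE coord_ofK.
case: (tensor_of s) => g j /=.
rewrite -(pair_bigA _ (fun (h : {ffun 'I_q -> 'I_q}) (j' : 'I_q) =>
  (\sum_i (x + res L i) ^+ j' * \prod_m (r ^+ h m * v 0 (h m + i))) *
  iota ((\prod_m t ^+ carry (g m) (h m - g m)) * (alg_poly e g h j %% AS p a)`_j'))) /=.
(* Distribute the product over m; the index l is translated by i so that h no longer
   depends on i. *)
transitivity (\sum_i \sum_(h : {ffun 'I_q -> 'I_q}) (x + res L i) ^+ j *
   \prod_m (r ^+ g m * (r ^+ (h m - g m)%R *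
     (map_poly iota (e (h m - g m))).[x + res L i + res L (g m)] * v 0 (h m + i)))).
  apply: eq_bigr => i _; rewrite -mulr_sumr; congr (_ * _).
  rewrite -(bigA_distr_bigA (fun m l => r ^+ g m * (r ^+ (l - g m)%R *
     (map_poly iota (e (l - g m))).[x + res L i + res L (g m)] * v 0 (l + i)))).
  apply: eq_bigr => m _; rewrite mxE -mulr_sumr; congr (_ * _).
  rewrite (reindex_inj (addIr i)) /=; apply: eq_bigr => l _.
  rewrite !mxE mulrC opprD addrACA subrr addr0 resD //.
  by rewrite -addrA [res L i + _]addrC.
rewrite exchange_big; apply: eq_bigr => h _ /=.
under [RHS]eq_bigr do rewrite mulr_suml.
rewrite exchange_big /=; apply: eq_bigr => i _.
transitivity (iota (\prod_m t ^+ carry (g m) (h m - g m)) *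
    (map_poly iota (alg_poly e g h j)).[x + res L i] *
    \prod_m (r ^+ h m * v 0 (h m + i))); last first.
  rewrite horner_modAS mulr_sumr mulr_suml; apply: eq_bigr => j' _.
  by rewrite rmorphM /= -!mulrA [LHS]mulrA [RHS]mulrA mulrC.
rewrite /alg_poly rmorphM /= hornerM map_polyXn hornerXn (rmorph_prod (map_poly iota)).
rewrite horner_prod (rmorph_prod iota) mulrCA -mulrA; congr (_ * _).
rewrite -!big_split /=; apply: eq_bigr => m _.
rewrite map_comp_poly horner_comp rmorphD /= map_polyX map_polyC !hornerE /=.
have wE : r ^+ g m * r ^+ (h m - g m)%R = r ^+ h m * iota t ^+ carry (g m) (h m - g m).
  by rewrite (expr_carry _ _ rt) addrC subrK.
rewrite -[LHS]/(r ^+ g m * r ^+ (h m - g m)%R * _ * _) wE rmorphXn; congr (_ * _).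
rewrite [RHS]mulrAC [_ * r ^+ h m]mulrC; congr (_ * _.[_ + _]).
exact/esym/rmorph_res.
Qed.

Section Representation.

Variables (gT : finGroupType) (e : gT -> 'I_q -> {poly K}).
Hypothesis e1 : alg_mx (e 1%g) = 1%:M.
Hypothesis eM : forall g h, exists2 c, c != 0 &
  alg_mx (e (g * h)%g) = c *: (alg_mx (e g) *m alg_mx (e h)).
Hypothesis e_faithful : forall g c, alg_mx (e g) = c%:M -> g = 1%g.

Definition SB_act g (P : proj_point L N) : proj_point L N :=
  pt (coords P *m (map_mx iota (alg_lift (e g)))^T).

Lemma alg_mx_unit g : alg_mx (e g) \in unitmx.
Proof.
have [c c_nz] := eM g g^-1; rewrite mulgV e1 => eq1.
have := unitmx1 L q; rewrite eq1 unitmxZ ?unitfE // unitmx_mul.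
by case/andP.
Qed.

Lemma alg_mx_nz g (v : 'rV[L]_q) : v != 0 -> v *m (alg_mx (e g))^T != 0.
Proof.
have Mu : (alg_mx (e g))^T \in unitmx by rewrite unitmx_tr alg_mx_unit.
by apply: contra_neq => e0; rewrite -[v](mulmxK Mu) e0 mul0mx.
Qed.

Lemma SB_actE g (P : proj_point L N) v : v != 0 -> has_coords P (Phi v) ->
  has_coords (SB_act g P) (Phi (v *m (alg_mx (e g))^T)).
Proof.
move=> v_nz Pv; have [c c_nz vE] := has_coords_proportional (has_coords_coords P) Pv.
rewrite phi_alg_mx vE -scalemxAl; apply: has_coordsZ => //; apply: has_coords_pt.
have : c *: (coords P *m (map_mx iota (alg_lift (e g)))^T) != 0.
  by rewrite scalemxAl -vE -phi_alg_mx (Phi_nz _ chK t_nz rt) // alg_mx_nz.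
by rewrite scaler_eq0 negb_or => /andP[].
Qed.

Lemma SB_act_regular g : regular_map iota X X (SB_act g).
Proof.
split=> [P PX|P PX].
  have [v v_nz Pv] := point_Phi_ex chK t_nz xa rt PX.
  exact: point_Phi (SB_actE g v_nz Pv).
exists 1%N, (fun s => \sum_s' alg_lift (e g) s s' *: 'X_s').
have hvE Q : (\row_s eval_at iota (\sum_s' alg_lift (e g) s s' *: 'X_s') (coords Q)) =
    coords Q *m (map_mx iota (alg_lift (e g)))^T.
  apply/rowP=> s; rewrite !mxE eval_atE rmorph_sum; apply: eq_bigr => s' _ /=.
  by rewrite mmapZ mmap_XU !mxE mulrC.
have hv_nz Q : point_of (X := X) iota Q ->
    coords Q *m (map_mx iota (alg_lift (e g)))^T != 0.
  move=> QX; have [v v_nz Qv] := point_Phi_ex chK t_nz xa rt QX.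
  have [c c_nz ->] := has_coords_proportional Qv (has_coords_coords Q).
  rewrite -scalemxAl -phi_alg_mx scaler_eq0 negb_or c_nz.
  by rewrite (Phi_nz _ chK t_nz rt) // alg_mx_nz.
split=> [s||Q QX _]; last by rewrite hvE; apply/has_coords_pt/hv_nz.
  by apply: rpred_sum => s' _; apply: rpredZ; apply: homogXU.
by rewrite hvE hv_nz.
Qed.

Lemma SB_actM g h (P : proj_point L N) : point_of (X := X) iota P ->
  SB_act (g * h)%g P = SB_act g (SB_act h P).
Proof.
move=> PX; have [v v_nz Pv] := point_Phi_ex chK t_nz xa rt PX.
have ghP := SB_actE g (alg_mx_nz h v_nz) (SB_actE h v_nz Pv).
have [c c_nz eE] := eM g h; have := SB_actE (g * h)%g v_nz Pv.
rewrite eE linearZ /= -scalemxAr trmx_mul mulmxA phiZ => hP.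
apply: has_coords_inj hP (has_coordsZ _ ghP).
exact: expf_neq0.
Qed.

Lemma SB_act1 (P : proj_point L N) : point_of (X := X) iota P -> SB_act 1%g P = P.
Proof.
move=> PX; have [v v_nz Pv] := point_Phi_ex chK t_nz xa rt PX.
have := SB_actE 1%g v_nz Pv; rewrite e1 trmx1 mulmx1 => hP.
exact: has_coords_inj hP Pv.
Qed.

Lemma SB_act_faithful g :
  (forall P : proj_point L N, point_of (X := X) iota P -> SB_act g P = P) -> g = 1%g.
Proof.
move=> fixP; have [v v_nz|c eE] := @all_eigen_scalar _ _ (alg_mx (e g))^T.
  have Pv : has_coords (pt (Phi v)) (Phi v).
    by apply: has_coords_pt; rewrite (Phi_nz _ chK t_nz rt).
  have := SB_actE g v_nz Pv; rewrite fixP; last exact: point_Phi Pv.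
  move=> Pgv; have [c _ vE] := Phi_inj chK t_nz rt v_nz (alg_mx_nz g v_nz) Pv Pgv.
  by exists c.
by apply: (@e_faithful g c); rewrite -[LHS]trmxK eE tr_scalar_mx.
Qed.

(** The group maps to the units of the cyclic algebra up to scalars of L. Faithfulness
    comes from the fact that a matrix fixing every line is scalar. *)
Theorem embeds_in_Aut_SB : embeds_in_Aut iota gT X.
Proof.
exists SB_act; split=> [g|g h P|g h gh]; last 2 first.
- exact: SB_actM.
- apply/esym/eqP; rewrite eq_mulVg1; apply/eqP; apply: SB_act_faithful => P PX.
  rewrite SB_actM // gh // -SB_actM // mulVg SB_act1 //.
split; first exact: SB_act_regular.
exists (SB_act g^-1); first exact: SB_act_regular.
by split=> P PX; rewrite -SB_actM // ?mulVg ?mulgV SB_act1.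
Qed.

End Representation.
End Automorphisms.

(** * Valuations of norms *)

Lemma frac_numden (R : idomainType) (z : {fraction R}) :
  exists2 d, d != 0 & exists n, z * tofrac d = tofrac n.
Proof.
pose y := repr z; exists \d_y; first exact: denom_ratioP.
exists \n_y; rewrite -[z]reprK -/y; unlock FracField.tofrac; rewrite -[LHS]FracField.pi_mul.
apply/eqmodP => /=; rewrite /FracField.mulf !numden_Ratio ?mulr1 ?oner_neq0 ?denom_ratioP //.
by rewrite /FracField.equivf !numden_Ratio ?oner_neq0 ?denom_ratioP // mulr1 mulrC.
Qed.

Lemma clear_denominators (R : idomainType) (P : {poly {fraction R}}) :
  exists2 d, d != 0 & exists Q : {poly R}, map_poly tofrac Q = tofrac d *: P.
Proof.
elim/poly_ind: P => [|P c [d d_nz [Q QE]]].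
  by exists 1; rewrite ?oner_neq0 //; exists 0; rewrite scaler0 rmorph0.
have [b b_nz [n nE]] := frac_numden c.
exists (b * d); first by rewrite mulf_neq0.
exists ((b *: Q) * 'X + (d * n)%:P).
rewrite rmorphD rmorphM /= map_polyX map_polyC /= map_polyZ /= QE !rmorphM /= -nE.
rewrite scalerDr scalerAl scalerA; congr (_ + _).
rewrite -mul_polyC -!polyCM; congr (_%:P).
by rewrite [c * _]mulrC mulrA [tofrac d * _]mulrC.
Qed.

Section Valuation.

Variables (F : fieldType).

Lemma polyXn_eq m n (U V : {poly F}) : U.[0] != 0 -> V.[0] != 0 ->
  'X^m * U = 'X^n * V -> m = n.
Proof.
have aux m' n' (U' V' : {poly F}) :
    (m' < n')%N -> U'.[0] != 0 -> 'X^m' * U' = 'X^n' * V' -> False.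
  move=> lt U0; rewrite -(subnKC (ltnW lt)) exprD -mulrA => e.
  have : U' = 'X^(n' - m') * V' by apply: mulfI e; rewrite -size_poly_gt0 size_polyXn.
  move=> UE; case/eqP: U0; rewrite UE hornerM hornerXn expr0n subn_eq0 leqNgt lt.
  by rewrite mul0r.
move=> U0 V0 e; case: (ltngtP m n) => // lt.
  by case: (aux _ _ _ _ lt U0 e).
by case: (aux _ _ _ _ lt V0 (esym e)).
Qed.

End Valuation.

Section NoNorm.

Variables (p : nat) (k Om : fieldType) (j : {rmorphism k -> Om}).
Local Notation q := p.+2.
Variables (al : k) (x0 : Om).
Hypothesis x0a : x0 ^+ q - x0 = j al.
Hypothesis x0_irr : forall c : {poly k}, c != 0 -> (size c <= q)%N ->
  forall i : 'I_q, (map_poly j c).[x0 + res Om i] != 0.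

Let evX (P : {poly {poly k}}) (z : {poly Om}) : {poly Om} := (map_poly (map_poly j) P).[z].

(** Divide Y by the largest power of t dividing all its coefficients. The quotient is
    nonzero at t = 0, and remains so after xi is specialized to any conjugate of x0,
    because the powers of x0 up to q - 1 are independent over k. *)
Lemma conjugate_valuations (Y : {poly {poly k}}) : Y != 0 -> (size Y <= q)%N ->
  exists n, forall i : 'I_q, exists2 U : {poly Om},
    evX Y (x0 + res Om i)%:P = 'X^n * U & U.[0] != 0.
Proof.
have [m] := ubnP (size (lead_coef Y)); elim: m Y => // m IH Y lt Y_nz sY.
have evx0 (P : {poly {poly k}}) z :
    (evX P z%:P).[0] = (map_poly j (map_poly (horner_eval 0) P)).[z].
  rewrite /evX -horner_evalE -horner_map /= horner_evalE hornerC.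
  rewrite -!map_poly_comp; congr (_.[_]); apply: eq_map_poly => b /=.
  by rewrite !horner_evalE -(rmorph0 j) horner_map.
have [c0|c_nz] := eqVneq (map_poly (horner_eval (0 : k)) Y) 0; last first.
  exists 0%N => i; exists (evX Y (x0 + res Om i)%:P); first by rewrite mul1r.
  by rewrite evx0 x0_irr // (leq_trans (size_poly _ _)).
pose Y' : {poly {poly k}} := \poly_(i < size Y) (Y`_i %/ 'X).
have YE : Y = 'X *: Y'.
  apply/polyP=> i; rewrite coefZ coef_poly; case: ltnP => [_|le]; last first.
    by rewrite mulr0 nth_default.
  have /(congr1 (coefp i)) := c0; rewrite /= coef_map coef0 /= horner_evalE => Yi0.
  by rewrite mulrC divpK // -['X]subr0 -polyC0 dvdp_XsubCl; apply/rootP.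
have Y'_nz : Y' != 0 by apply: contraNneq Y_nz => Y0; rewrite YE Y0 scaler0.
have lt' : (size (lead_coef Y') < m)%N.
  by move: lt; rewrite YE lead_coefZ mulrC size_mulX ?lead_coef_eq0.
have [n nP] := IH Y' lt' Y'_nz (leq_trans (size_poly _ _) sY).
exists n.+1 => i; have [U UE U0] := nP i; exists U => //.
rewrite exprS -mulrA -UE YE /evX map_polyZ /= map_polyX -mul_polyC hornerM hornerC.
by [].
Qed.

(** The divisibility says that t N(Y0) = N(Y1) in K(xi). By conjugate_valuations the
    t-adic valuations of both norms would be multiples of q. *)
Lemma not_norm (Y0 Y1 : {poly {fraction {poly k}}}) :
  Y0 != 0 -> (size Y0 <= q)%N -> (size Y1 <= q)%N ->
  ~~ (AS p (tofrac al%:P) %| (tofrac 'X)%:P * \prod_(i < q) (Y0 \Po ('X + (res _ i)%:P)) -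
     \prod_(i < q) (Y1 \Po ('X + (res _ i)%:P))).
Proof.
move=> Y0_nz sY0 sY1; apply/negP => dvd.
have [d0 d0_nz [Z0 Z0E]] := clear_denominators Y0.
have [d1 d1_nz [Z1 Z1E]] := clear_denominators Y1.
(* With a common denominator d, both norms are multiplied by d^q. *)
pose W0 := d1 *: Z0; pose W1 := d0 *: Z1; pose d := tofrac (d0 * d1).
have d_nz : d != 0 by rewrite tofrac_eq0 mulf_neq0.
have W0E : map_poly tofrac W0 = d *: Y0.
  by rewrite map_polyZ Z0E scalerA -rmorphM mulrC.
have W1E : map_poly tofrac W1 = d *: Y1.
  by rewrite map_polyZ Z1E scalerA -rmorphM.
have inj : injective (map_poly (@FracField.tofrac {poly k})).
  by apply: map_inj_poly; rewrite ?tofrac0 // => u v /eqP; rewrite tofrac_eq => /eqP.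
have sW (W : {poly {poly k}}) Y : map_poly tofrac W = d *: Y -> size W = size Y.
  move=> e; rewrite -(size_scale Y d_nz) -e size_map_inj_poly ?tofrac0 // => u v /eqP.
  by rewrite tofrac_eq => /eqP.
have W0_nz : W0 != 0 by rewrite -size_poly_gt0 (sW _ _ W0E) size_poly_gt0.
pose D := ('X%:P * \prod_(i < q) (W0 \Po ('X + (res _ i)%:P)) -
           \prod_(i < q) (W1 \Po ('X + (res {poly k} i)%:P)) : {poly {poly k}}).
have mapW (W : {poly {poly k}}) Y i : map_poly tofrac W = d *: Y ->
    map_poly tofrac (W \Po ('X + (res {poly k} i)%:P)) =
    d *: (Y \Po ('X + (res {fraction {poly k}} i)%:P)).
  move=> e; rewrite map_comp_poly e comp_polyZ rmorphD /= map_polyX map_polyC /=.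
  by rewrite (rmorph_res tofrac).
have prodW (W : {poly {poly k}}) Y : map_poly tofrac W = d *: Y ->
    map_poly tofrac (\prod_(i < q) (W \Po ('X + (res {poly k} i)%:P))) =
    d ^+ q *: \prod_(i < q) (Y \Po ('X + (res {fraction {poly k}} i)%:P)).
  move=> e; rewrite rmorph_prod -[in d ^+ q](card_ord q) -prodr_const -scaler_prod.
  by apply: eq_bigr => i _; apply: mapW.
have mapD : map_poly tofrac D = d ^+ q *:
    ((tofrac 'X)%:P * \prod_(i < q) (Y0 \Po ('X + (res _ i)%:P)) -
     \prod_(i < q) (Y1 \Po ('X + (res _ i)%:P))).
  rewrite rmorphB rmorphM /= (prodW _ _ W0E) (prodW _ _ W1E) map_polyC.
  by rewrite -scalerAr scalerBr.
(* The Artin-Schreier polynomial is monic with coefficients in k, so the division takes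
   place over k[t]. *)
have [Q DE] : exists Q, D = Q * AS p al%:P.
  exists (Pdiv.CommonRing.rdivp D (AS p al%:P)).
  rewrite [LHS](Pdiv.RingMonic.rdivp_eq (monic_AS p al%:P)).
  rewrite [X in _ + X](_ : _ = 0) ?addr0 //; apply: inj; rewrite rmorph0.
  set R := Pdiv.CommonRing.rmodp _ _.
  have : AS p (tofrac al%:P) %| map_poly tofrac R.
    move: dvd; rewrite -(dvdpZr _ _ (expf_neq0 q d_nz)) -mapD.
    rewrite {1}(Pdiv.RingMonic.rdivp_eq (monic_AS p al%:P) D) rmorphD rmorphM /= map_AS.
    by rewrite dvdp_addr // dvdp_mulIr.
  apply: contraTeq => R_nz; rewrite gtNdvdp // size_AS.
  rewrite size_map_inj_poly ?tofrac0 //; last first.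
    by move=> u v /eqP; rewrite tofrac_eq => /eqP.
  by have := Pdiv.CommonRing.ltn_rmodp D (AS p al%:P); rewrite size_AS -size_poly_gt0 size_AS.
have DX : evX D x0%:P = 0.
  have mAS : map_poly (map_poly j) (AS p al%:P) = AS p (j al)%:P.
    by rewrite map_AS; congr AS; apply: map_polyC.
  rewrite DE /evX rmorphM /= mAS hornerM /AS !hornerE.
  by rewrite -polyC_exp -!polyCB x0a subrr mulr0.
have evW (W : {poly {poly k}}) (i : 'I_q) :
    evX (W \Po ('X + (res {poly k} i)%:P)) x0%:P = evX W (x0 + res Om i)%:P.
  rewrite /evX map_comp_poly horner_comp rmorphD /= map_polyX map_polyC !hornerE.
  congr (_.[_]); rewrite polyCD; congr (_ + _).
  by rewrite /res polyC_natr; apply: rmorph_nat.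
have evB P Q' z : evX (P - Q') z = evX P z - evX Q' z.
  by rewrite /evX rmorphB hornerD hornerN.
have evM P Q' z : evX (P * Q') z = evX P z * evX Q' z by rewrite /evX rmorphM hornerM.
have evt z : evX 'X%:P z = 'X by rewrite /evX map_polyC /= map_polyX hornerC.
have ev_prod (W : {poly {poly k}}) :
    evX (\prod_(i < q) (W \Po ('X + (res {poly k} i)%:P))) x0%:P =
    \prod_(i < q) evX W (x0 + res Om i)%:P.
  by rewrite /evX rmorph_prod horner_prod; apply: eq_bigr => i _; apply: evW.
have evD : 'X * \prod_(i < q) evX W0 (x0 + res Om i)%:P =
           \prod_(i < q) evX W1 (x0 + res Om i)%:P.
  by apply/eqP; rewrite -subr_eq0 -!ev_prod -{1}(evt x0%:P) -evM -evB DX.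
have [n0 /fin_all_exists2[U UE U0]] :=
  conjugate_valuations W0_nz (leq_trans (eq_leq (sW _ _ W0E)) sY0).
have prodE n (V : 'I_q -> {poly Om}) : \prod_i ('X^n * V i) = 'X^(n * q) * \prod_i V i.
  by rewrite big_split prodr_const card_ord -exprM.
have prod0 (V : 'I_q -> {poly Om}) : (forall i, (V i).[0] != 0) -> (\prod_i V i).[0] != 0.
  by move=> V0; rewrite horner_prod; apply/prodf_neq0 => i _; apply: V0.
have ev0 z : evX 0 z = 0 by rewrite /evX rmorph0 horner0.
(* Otherwise N(Y0) would vanish. *)
have W1_nz : W1 != 0.
  apply/eqP => W10; move: evD; rewrite W10 [RHS](bigD1 0) //= ev0 mul0r.
  rewrite (eq_bigr (fun i => 'X^n0 * U i)) // prodE mulrA -exprS => /eqP.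
  rewrite mulf_eq0 expf_eq0 polyX_eq0 andbF /= => /eqP P0.
  by have := prod0 _ U0; rewrite P0 horner0 eqxx.
have [n1 /fin_all_exists2[V VE V0]] :=
  conjugate_valuations W1_nz (leq_trans (eq_leq (sW _ _ W1E)) sY1).
move: evD; rewrite (eq_bigr (fun i => 'X^n0 * U i)) //.
rewrite [RHS](eq_bigr (fun i => 'X^n1 * V i)) // !prodE mulrA -exprS.
move=> /(polyXn_eq (prod0 _ U0) (prod0 _ V0)) e.
have : (q %| (n0 * q).+1)%N by rewrite e dvdn_mull.
by rewrite -[(n0 * q).+1]addn1 dvdn_addr ?dvdn_mull // dvdn1.
Qed.

End NoNorm.

(** * Rational points and norms *)

Section RationalPoints.

Variables (p : nat).
Local Notation q := p.+2.
Local Notation N := (ambient_dim p).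
Variables (K : fieldType) (a t : K) (L : closedFieldType).
Variables (iota : {rmorphism K -> L}) (x r : L).
Hypotheses (chK : q \in [pchar K]) (t_nz : t != 0).
Hypotheses (xa : x ^+ q - x = iota a) (rt : r ^+ q = iota t).
Implicit Types l : 'I_q.

Let chL : q \in [pchar L]. Proof. by rewrite (fmorph_pchar iota). Qed.

Local Notation X := (SB p a t).
Local Notation Phi := (phi x r).

(** The element of K(xi) with the trace coordinates y_(f, j), as given by trace_dual. *)
Definition coord_poly (y : 'rV[K]_N.+1) (f : {ffun 'I_q -> 'I_q}) : {poly K} :=
  (y 0 (coord_of (f, 0)))%:P - \sum_(j < q) y 0 (coord_of (f, rev_ord j)) *: 'X^j.

Lemma size_coord_poly y f : (size (coord_poly y f) <= q)%N.
Proof.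
rewrite (leq_trans (size_polyD _ _)) // geq_max size_polyN; apply/andP; split.
  by rewrite (leq_trans (size_polyC_leq1 _)).
rewrite (leq_trans (size_sum _ _ _)) //; apply/bigmax_leqP => j _.
by rewrite (leq_trans (size_scale_leq _ _)) // size_polyXn.
Qed.

Lemma coord_polyE y f c (v : 'rV[L]_q) l : map_mx iota y = c *: Phi v ->
  (map_poly iota (coord_poly y f)).[x + res L l] =
  c * (weight r f * \prod_m v 0 (f m + l)).
Proof.
move=> yE; have yv j : iota (y 0 (coord_of (f, j))) = c * Phi v 0 (coord_of (f, j)).
  by have /rowP/(_ (coord_of (f, j))) := yE; rewrite !mxE.
have := @trace_dual p L chL x (fun i => c * (weight r f * \prod_m v 0 (f m + i)))
  (fun j => iota (y 0 (coord_of (f, j)))) l.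
move=> <- => [|j]; last first.
  rewrite yv phi_weight mulrA mulr_sumr; apply: eq_bigr => i _.
  by rewrite mulrCA -[c * _ * _]mulrA.
rewrite rmorphB rmorph_sum hornerD hornerN horner_sum /= map_polyC hornerC.
congr (_ - _); apply: eq_bigr => j _.
by rewrite map_polyZ /= map_polyXn hornerZ hornerXn.
Qed.

(** For a rational point, the tensors v_l^q and v_(l+1) v_l^(q-1), the latter with the
    weight r, are the conjugates of two elements Y0 and Y1 of K(xi). The products of
    both families over l agree up to r^q = t. *)
Lemma rational_point_norm (y : 'rV[K]_N.+1) c (v : 'rV[L]_q) :
  map_mx iota y = c *: Phi v -> c != 0 -> v != 0 ->
  exists Y0 Y1 : {poly K}, [/\ Y0 != 0, (size Y0 <= q)%N, (size Y1 <= q)%N &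
    AS p a %| t%:P * \prod_(i < q) (Y0 \Po ('X + (res _ i)%:P)) -
      \prod_(i < q) (Y1 \Po ('X + (res _ i)%:P))].
Proof.
move=> yE c_nz /rV0Pn[l0 vl0].
pose f1 : {ffun 'I_q -> 'I_q} := hook_index 0 1.
have w0 : weight r (const_index (0 : 'I_q)) = 1.
  by rewrite /weight big1 // => m _; rewrite ffunE expr0.
have w1 : weight r f1 = r.
  by rewrite /weight big_ord_recl ffunE big1 ?mulr1 ?expr1 // => m _; rewrite ffunE.
have p0 l : \prod_m v 0 (const_index 0 m + l) = v 0 l ^+ q.
  rewrite (eq_bigr (fun=> v 0 l)) ?prodr_const ?card_ord // => m _.
  by rewrite ffunE add0r.
have p1 l : \prod_m v 0 (f1 m + l) = v 0 (1 + l) * v 0 l ^+ p.+1.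
  rewrite big_ord_recl ffunE /= (eq_bigr (fun=> v 0 l)) ?prodr_const ?card_ord // => m _.
  by rewrite ffunE /= add0r.
exists (coord_poly y (const_index 0)), (coord_poly y f1); split; rewrite ?size_coord_poly //.
  apply: contra_neq (mulf_neq0 c_nz (expf_neq0 q vl0)) => Y0.
  have := coord_polyE (const_index 0) l0 yE.
  by rewrite Y0 rmorph0 horner0 w0 mul1r p0.
apply/(AS_dvd_map chK _ xa) => l.
have conjE (Y : {poly K}) :
    (map_poly iota (\prod_(i < q) (Y \Po ('X + (res K i)%:P)))).[x + res L l] =
    \prod_(i < q) (map_poly iota Y).[x + res L i].
  rewrite rmorph_prod horner_prod [RHS](reindex_inj (addrI l)) /=.
  apply: eq_bigr => i _.
  rewrite map_comp_poly horner_comp rmorphD /= map_polyX map_polyC !hornerE.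
  by rewrite resD // addrA; congr (_.[_ + _]); apply: rmorph_res.
rewrite rmorphB rmorphM hornerD hornerN hornerM !conjE /= map_polyC hornerC /= -rt.
apply/eqP; rewrite subr_eq0; apply/eqP.
rewrite (eq_bigr (fun i => c * v 0 i ^+ q)); last first.
  by move=> i _; rewrite (coord_polyE _ _ yE) w0 mul1r p0.
rewrite [RHS](eq_bigr (fun i => r * (c * (v 0 (1 + i) * v 0 i ^+ p.+1)))); last first.
  by move=> i _; rewrite (coord_polyE _ _ yE) w1 p1 mulrCA.
rewrite [RHS]big_split prodr_const card_ord; congr (_ * _).
rewrite !big_split; congr (_ * _).
have -> : \prod_(i < q) v 0 (1 + i) = \prod_(i < q) v 0 i.
  by rewrite [RHS](reindex_inj (addrI 1)).
rewrite -big_split.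
by apply: eq_bigr => i _.
Qed.

(** Projective space has points over K, and an isomorphism defined over K carries them
    to points of the variety over K. *)
Lemma trivial_norm : isomorphic iota X (proj_space K p.+1) ->
  exists Y0 Y1 : {poly K}, [/\ Y0 != 0, (size Y0 <= q)%N, (size Y1 <= q)%N &
    AS p a %| t%:P * \prod_(i < q) (Y0 \Po ('X + (res _ i)%:P)) -
      \prod_(i < q) (Y1 \Po ('X + (res _ i)%:P))].
Proof.
case=> f [_ [g [gX greg] _]].
pose d0 : 'rV[K]_q := delta_mx 0 0.
have d0_nz : map_mx iota d0 != 0.
  by apply/rV0Pn; exists 0; rewrite !mxE !eqxx rmorph1 oner_neq0.
pose P0 : proj_point L p.+1 := pt (map_mx iota d0).
have P0X : point_of (X := proj_space K p.+1) iota P0 by [].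
have [d [h [hh hv_nz hvP]]] := greg P0 P0X.
have [c c_nz P0E] := has_coords_proportional (has_coords_pt d0_nz) (has_coords_coords P0).
pose y : 'rV[K]_N.+1 := \row_s mmap idfun (d0 0) (h s).
have hvE : \row_i eval_at iota (h i) (coords P0) = c ^+ d *: map_mx iota y.
  apply/rowP=> s; rewrite !mxE P0E (eval_at_homog _ _ _ (hh s)) eval_atE rmorph_mmap.
  by congr (_ * _); apply: eq_mmap => // i; rewrite /= !mxE.
have := hvP P0 P0X hv_nz; rewrite hvE => gP.
have yP : has_coords (g P0) (map_mx iota y).
  have cd : c ^+ d != 0 by rewrite expf_neq0.
  by have := has_coordsZ (invr_neq0 cd) gP; rewrite scalerA mulVf // scale1r.
have [v v_nz Pv] := point_Phi_ex chK t_nz xa rt (gX P0 P0X).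
have [b b_nz yE] := has_coords_proportional Pv yP.
exact: rational_point_norm yE b_nz v_nz.
Qed.

End RationalPoints.

(** * Derivatives of products of units *)

Section ReducedDerivative.

Variables (p : nat) (k : fieldType).
Local Notation q := p.+2.
Hypothesis chk : q \in [pchar k].

Definition leading m (h : {poly k}) (be : k) :=
  exists g, h = 1 + be *: 'X^(m.+1) + 'X^(m.+2) * g.

Lemma leading1 m : leading m 1 0.
Proof. by exists 0; rewrite scale0r mulr0 !addr0. Qed.

Lemma leadingM m h h' be be' :
  leading m h be -> leading m h' be' -> leading m (h * h') (be + be').
Proof.
move=> [g ->] [g' ->].
exists (g + g' + be%:P * be'%:P * 'X^m + be%:P * 'X^(m.+1) * g' +
        be'%:P * 'X^(m.+1) * g + 'X^(m.+2) * g * g').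
by rewrite -!mul_polyC polyCD !exprS; ring.
Qed.

Lemma leadingX m h be n : leading m h be -> leading m (h ^+ n) (be *+ n).
Proof.
move=> lh; elim: n => [|n IH]; first by rewrite mulr0n; apply: leading1.
by rewrite exprS mulrS; apply: leadingM.
Qed.

(** The least i with b i <> 0 shows in the coefficient of X^(i q + 1). This degree is 1
    modulo q, so that the coefficient survives derivation. *)
Lemma deriv_prod_eq0 M (b : 'I_M -> nat) : (forall i, b i < q)%N ->
  (\prod_(i < M) (1 + 'X^((i * q).+1)) ^+ b i : {poly k})^`() = 0 -> forall i, b i = 0%N.
Proof.
move=> ltb h0 i; have [n] := ubnP (i : nat); elim: n i => // n IH i lti.
have b0 (l : 'I_M) : (l < i)%N -> b l = 0%N.
  by move=> li; apply: IH; apply: leq_trans li _.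
have : leading (i * q) (\prod_(l < M) (1 + 'X^((l * q).+1)) ^+ b l)
         (\sum_(l < M) (l == i)%:R *+ b l).
  elim/big_ind2: _ => [||l _]; [exact: leading1 | by move=> *; apply: leadingM |].
  (* Factors with l < i are 1 by the choice of i, and those with l > i are 1 up to
     higher order. *)
  case: (ltngtP l i) => [/b0 ->|il|/ord_inj ->]; first by rewrite mulr0n; apply: leading1.
    rewrite -val_eqE /= gtn_eqF //; apply: leadingX.
    exists 'X^(((l - i) * q).-1); rewrite scale0r addr0 -exprD; congr (1 + 'X^_).
    by rewrite mulnBl; have : (i * q < l * q)%N; [rewrite ltn_mul2r | lia].
  by rewrite eqxx; apply: leadingX; exists 0; rewrite scale1r mulr0 addr0.
have -> : \sum_(l < M) (l == i)%:R *+ b l = (b i)%:R :> k.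
  by rewrite (bigD1 i) //= eqxx big1 ?addr0 // => l /negPf ->; rewrite mul0rn.
move=> [g hE].
move/(congr1 (fun f : {poly k} => f`_(i * q))): h0.
rewrite hE coef0 coef_deriv !coefD coefZ coefXn eqxx coef1 coefXnM ltnSn add0r addr0 mulr1.
rewrite -[_ *+ _]mulr_natr mulrC.
have -> : ((i * q).+1%:R : k) = 1 by rewrite -addn1 natrD natrM (pcharf0 chk) mulr0 add0r.
rewrite mul1r => /eqP; rewrite -(dvdn_pcharf chk) => /dvdnP[[|m] e] //.
by have := ltb i; rewrite e mulSn ltnNge leq_addr.
Qed.

End ReducedDerivative.

(** * The inseparable subfield and elementary abelian groups *)

Section InseparableElements.

Variables (p : nat).
Local Notation q := p.+2.
Local Notation N := (ambient_dim p).
Variables (K : fieldType) (a t : K) (L : closedFieldType).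
Variables (iota : {rmorphism K -> L}) (x r : L).
Hypotheses (chK : q \in [pchar K]) (t_nz : t != 0).
Hypotheses (xa : x ^+ q - x = iota a) (rt : r ^+ q = iota t).
Implicit Types l : 'I_q.

Let chL : q \in [pchar L]. Proof. by rewrite (fmorph_pchar iota). Qed.

Definition shift_mx : 'M[L]_q := \matrix_(i, l) (r *+ (l == i + 1)).

Lemma shift_mxX m i l : (shift_mx ^+ m) i l = r ^+ m *+ (l == i + m%:R).
Proof.
elim: m l => [|m IH] l; first by rewrite !expr0 mxE mulr0n addr0 eq_sym.
rewrite exprSr mxE (bigD1 (i + m%:R)) //= big1 => [|j /negPf nj]; last first.
  by rewrite IH nj mulr0n mul0r.
rewrite IH eqxx mulr1n mxE addr0 mulrS [1 + _]addrC addrA exprSr.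
by rewrite mulrnAr.
Qed.

Lemma shift_mxXq : shift_mx ^+ q = (iota t)%:M.
Proof.
apply/matrixP=> i l; rewrite shift_mxX mxE rt eq_sym.
by rewrite (_ : q%:R = 0 :> 'I_q) ?addr0 //; apply/val_inj; rewrite Zp_nat /= modnn.
Qed.

(** The component of u^s in H(u), with u^q replaced by t. *)
Definition inseparable_part (H : {poly K}) (s : 'I_q) : K :=
  \sum_(m < size H) (H`_m * t ^+ (m %/ q)) *+ (m%:R == s).

Definition inseparable_coef (H : {poly K}) (s : 'I_q) : {poly K} :=
  (inseparable_part H s)%:P.

Lemma alg_mx_inseparable H :
  alg_mx iota x r (inseparable_coef H) = horner_mx shift_mx (map_poly iota H).
Proof.
rewrite -{2}[H]coefK poly_def !rmorph_sum; apply/matrixP=> i l; rewrite mxE summxE.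
have [s sE] : exists s, s = l - i by exists (l - i).
rewrite -sE.
rewrite /inseparable_coef map_polyC hornerC /= /inseparable_part (rmorph_sum iota) mulr_sumr /=.
apply: eq_bigr => m _; rewrite map_polyZ /= map_polyXn horner_mxZ rmorphXn /= horner_mx_X.
rewrite mxE shift_mxX rmorphMn rmorphM rmorphXn /= -rt.
have -> : (l == i + m%:R) = (m%:R == s).
  by rewrite [RHS]eq_sym sE subr_eq addrC.
case: eqP => [<-|_]; last by rewrite !mulr0n !mulr0.
rewrite !mulr1n mulrCA; congr (_ * _); rewrite -exprM -exprD; congr (_ ^+ _).
by rewrite Zp_nat /= mulnC addnC -divn_eq.
Qed.

Lemma alg_mx_inseparableM c A B C :
  horner_mx shift_mx (map_poly iota C) =
    c *: (horner_mx shift_mx (map_poly iota A) *m horner_mx shift_mx (map_poly iota B)) ->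
  alg_mx iota x r (inseparable_coef C) =
    c *: (alg_mx iota x r (inseparable_coef A) *m alg_mx iota x r (inseparable_coef B)).
Proof. by rewrite !alg_mx_inseparable. Qed.

(** The vector with all entries 1 is an eigenvector of the matrix of u with eigenvalue
    r. So if H(u) is scalar, then the scalar is H(r); it is also the component of u^0,
    which lies in K. *)
Lemma inseparable_scalar H c : alg_mx iota x r (inseparable_coef H) = c%:M ->
  (map_poly iota H).[r] = iota (inseparable_part H 0).
Proof.
move=> e; transitivity (\sum_l alg_mx iota x r (inseparable_coef H) 0 l).
  rewrite alg_mx_inseparable -{1 2}[H]coefK poly_def !rmorph_sum /= horner_sum.
  transitivity (\sum_l \sum_(m < size H) iota H`_m * (r ^+ m *+ (l == m%:R :> 'I_q))).
    rewrite exchange_big; apply: eq_bigr => m _.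
    rewrite map_polyZ /= map_polyXn hornerZ hornerXn -mulr_sumr; congr (_ * _).
    by rewrite (bigD1 m%:R) //= eqxx big1 ?addr0 // => l /negPf ->.
  apply: eq_bigr => l _; rewrite summxE; apply: eq_bigr => m _.
  rewrite map_polyZ /= map_polyXn horner_mxZ rmorphXn /= horner_mx_X.
  by rewrite mxE shift_mxX add0r.
have off l : l != 0 -> alg_mx iota x r (inseparable_coef H) 0 l = 0.
  by move=> l0; rewrite e mxE eq_sym (negPf l0).
rewrite (bigD1 0) //= big1 // addr0 mxE subrr expr0 mul1r.
by rewrite /inseparable_coef map_polyC hornerC.
Qed.

End InseparableElements.

Section Elementary.

Variables (p : nat).
Local Notation q := p.+2.
Variables (k : fieldType) (L : closedFieldType).
Variables (iota : {rmorphism {fraction {poly k}} -> L}) (al : k) (x r : L).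
Hypothesis chk : q \in [pchar k].
Local Notation K := {fraction {poly k}}.
Local Notation a := (tofrac al%:P : K).
Local Notation t := (tofrac 'X : K).
Hypotheses (xa : x ^+ q - x = iota a) (rt : r ^+ q = iota t).

Lemma pchar_frac : q \in [pchar K].
Proof.
rewrite inE; have /andP[-> /eqP q0] := chk.
by rewrite -(rmorph_nat (@FracField.tofrac {poly k})) -polyC_natr q0 polyC0 rmorph0 eqxx.
Qed.

Let chL : q \in [pchar L]. Proof. by rewrite (fmorph_pchar iota) pchar_frac. Qed.

Lemma t_nz : t != 0.
Proof. by rewrite tofrac_eq0 polyX_eq0. Qed.

Lemma frac_infinite n : exists s : seq K, uniq s /\ (n < size s)%N.
Proof.
exists [seq t ^+ i | i <- seq.iota 0 n.+1]; rewrite size_map size_iota; split=> //.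
rewrite map_inj_uniq ?iota_uniq // => i j /eqP.
rewrite -!rmorphXn tofrac_eq => /eqP/(congr1 (fun f : {poly k} => size f)).
by rewrite !size_polyXn => -[].
Qed.

Let ka : {rmorphism k -> L} := iota \o (@FracField.tofrac {poly k} \o @polyC k).

Lemma iota_frac (A : {poly k}) : iota (tofrac A) = (map_poly ka (A \Po 'X^q)).[r].
Proof.
rewrite map_comp_poly horner_comp map_polyXn hornerXn rt.
rewrite -{1}[A]comp_polyXr /comp_poly -!horner_map -!map_poly_comp.
by congr (_.[_]).
Qed.

(** The q-th power of the relation g(r) = 0 is a polynomial relation for t. *)
Lemma r_transcendental (g : {poly k}) : (map_poly ka g).[r] = 0 -> g = 0.
Proof.
move=> g0; pose g' := map_poly (pFrobenius_aut chk) g.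
have : iota (tofrac g') = 0.
  rewrite iota_frac map_comp_poly horner_comp map_polyXn hornerXn.
  rewrite -(pFrobenius_autE chL) -[RHS](rmorph0 (pFrobenius_aut chL)) -g0 -horner_map.
  rewrite -!map_poly_comp; congr (_.[_]); apply: eq_map_poly => c /=.
  by rewrite !pFrobenius_autE !rmorphXn.
move/eqP; rewrite fmorph_eq0 tofrac_eq0 => /eqP g'0.
apply/polyP=> i; rewrite coef0; have /(congr1 (fun f : {poly k} => f`_i)) := g'0.
by rewrite coef_map coef0 /= pFrobenius_autE => /eqP; rewrite expf_eq0 => /andP[_ /eqP].
Qed.

(** A polynomial h with h(r) in k(t) is a quotient of polynomials in X^q, and these have
    derivative 0. *)
Lemma rational_value_deriv (h : {poly k}) (c : K) : (map_poly ka h).[r] = iota c -> h^`() = 0.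
Proof.
move=> hr; have [B B_nz [A AE]] := frac_numden c.
have hB : h * (B \Po 'X^q) = A \Po 'X^q.
  apply/eqP; rewrite -subr_eq0; apply/eqP/r_transcendental.
  rewrite rmorphB rmorphM hornerD hornerN hornerM -!iota_frac hr -rmorphM AE.
  exact: subrr.
have dq (C : {poly k}) : (C \Po 'X^q)^`() = 0.
  by rewrite deriv_comp derivXn -mulr_natr -polyC_natr (pcharf0 chk) polyC0 !mulr0.
have := dq A; rewrite -hB derivM dq mulr0 addr0 => /eqP.
rewrite mulf_eq0 => /orP[/eqP//|].
by rewrite comp_poly_eq0 ?size_polyXn // (negPf B_nz).
Qed.

Variable M : nat.

(** The q-th power of 1 + t^i u is 1 + t^(iq+1), an element of K; so the exponents b
    matter only modulo q. *)
Definition unit_prod (b : 'rV['Z_q]_M) : {poly K} :=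
  \prod_(i < M) (1 + (t ^+ i)%:P * 'X) ^+ (b 0 i).

Lemma one_plus_tX_nz m : 1 + t ^+ m.+1 != 0.
Proof.
rewrite -rmorphXn -(rmorph1 (@FracField.tofrac {poly k})) -rmorphD tofrac_eq0.
by rewrite addrC -size_poly_gt0 size_polyDl ?size_polyXn // size_poly1.
Qed.

Lemma unit_prodM (g h : 'rV['Z_q]_M) : exists2 c, c != 0 &
  horner_mx (shift_mx p r) (map_poly iota (unit_prod (g + h))) =
    c *: (horner_mx (shift_mx p r) (map_poly iota (unit_prod g)) *m
          horner_mx (shift_mx p r) (map_poly iota (unit_prod h))).
Proof.
pose c : K := \prod_(i < M) (1 + t ^+ (i * q).+1) ^+ carry (g 0 i : 'I_q) (h 0 i).
have c_nz : iota c != 0.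
  by rewrite fmorph_eq0; apply/prodf_neq0 => i _; rewrite expf_neq0 // one_plus_tX_nz.
exists (iota c)^-1; rewrite ?invr_neq0 //; apply: (canRL (scalerK c_nz)).
rewrite -[RHS]rmorphM -rmorphM /=.
have -> : unit_prod g * unit_prod h = unit_prod (g + h) *
    \prod_(i < M) ((1 + (t ^+ i)%:P * 'X) ^+ q) ^+ carry (g 0 i : 'I_q) (h 0 i).
  rewrite -!big_split; apply: eq_bigr => i _ /=.
  by rewrite (@expr_carry p _ _ _ (g 0 i) (h 0 i) (erefl _)) mxE.
rewrite !rmorphM /= -[LHS]mul_scalar_mx [RHS]comm_horner_mx2; congr (_ * _).
have key (i : 'I_M) : horner_mx (shift_mx p r) (map_poly iota ((1 + (t ^+ i)%:P * 'X) ^+ q)) =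
    (iota (1 + t ^+ (i * q).+1))%:M.
  rewrite frobD ?pchar_poly ?pchar_frac // expr1n exprMn -polyC_exp -exprM.
  rewrite [iota _]rmorphD [in RHS]rmorph1 (raddfD (@scalar_mx L q)) /=.
  rewrite [t ^+ (_).+1]exprSr [iota _]rmorphM /= scalar_mxM.
  rewrite [map_poly _ _]rmorphD rmorph1 rmorphM /= map_polyXn map_polyC /=.
  rewrite rmorphD rmorph1 rmorphM /= horner_mx_C; congr (_ + _ *m _).
  by rewrite -(shift_mxXq rt) rmorphXn /= horner_mx_X.
rewrite /c (rmorph_prod iota) (rmorph_prod (@scalar_mx L q)) !rmorph_prod.
apply: eq_bigr => i _ /=; rewrite [iota _]rmorphXn [_%:M]rmorphXn /= -key.
by rewrite [map_poly iota (_ ^+ carry _ _)]rmorphXn [RHS]rmorphXn.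
Qed.

(** If the product of the (1 + t^i u)^(b i) is scalar, the polynomial obtained by
    writing u and t as r and r^q has derivative 0, and deriv_prod_eq0 gives b = 0. *)
Theorem elementary_abelian_embeds : embeds_in_Aut iota 'rV['Z_q]_M (SB p a t).
Proof.
apply: (embeds_in_Aut_SB pchar_frac t_nz xa rt frac_infinite
  (e := fun b : 'rV['Z_q]_M => inseparable_coef t (unit_prod b))) => [|g h|g c e].
- rewrite (alg_mx_inseparable _ rt) /unit_prod big1 ?rmorph1 // => i _.
  by rewrite mxE expr0.
- have [c c_nz cE] := unit_prodM g h.
  by exists c => //; exact: (alg_mx_inseparableM x rt cE).
have gr : (map_poly ka (\prod_(i < M) (1 + 'X^((i * q).+1)) ^+ (g 0 i))).[r] =
    iota (inseparable_part t (unit_prod g) (0 : 'I_q)).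
  rewrite -(inseparable_scalar rt e) /unit_prod !rmorph_prod !horner_prod.
  apply: eq_bigr => i _; rewrite (rmorphXn (map_poly ka)) (rmorphXn (map_poly iota)).
  rewrite !horner_exp; congr (_ ^+ _).
  rewrite !rmorphD !rmorph1 rmorphM /= !map_polyXn map_polyX map_polyC.
  by rewrite !hornerE /= rmorphXn /= -rt -exprM exprSr mulnC.
have g0 := deriv_prod_eq0 chk _ (rational_value_deriv gr).
apply/rowP=> i; rewrite mxE; apply/val_inj; apply: g0 => l; exact: ltn_ord.
Qed.

End Elementary.

(** * Subfields from closed predicates *)

Section SubField.

Variables (F : fieldType) (S : {pred F}).

(** The phantom argument carries the closure property, so that the subring structure can
    be attached to this constant. *)
Definition closed_pred of divring_closed S : {pred F} := S.

Variable hS : divring_closed S.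

HB.instance Definition _ := GRing.isDivringClosed.Build F (closed_pred hS) hS.

Record sub_field := SubFieldElt { sub_val :> F; _ : sub_val \in closed_pred hS }.

HB.instance Definition _ := [isSub for sub_val].
HB.instance Definition _ := [Choice of sub_field by <:].
HB.instance Definition _ := [SubChoice_isSubIntegralDomain of sub_field by <:].
HB.instance Definition _ := [SubIntegralDomain_isSubField of sub_field by <:].

End SubField.

Lemma subfield_of_Prop (F : fieldType) (P : F -> Prop) :
  P 1 -> (forall y z, P y -> P z -> P (y - z)) -> (forall y z, P y -> P z -> P (y / z)) ->
  exists (k : fieldType) (j : {rmorphism k -> F}), forall z, P z <-> exists c, j c = z.
Proof.
move=> P1 PB PV; pose S : {pred F} := fun z => excluded_middle_informative (P z) : bool.
have SP z : reflect (P z) (z \in S).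
  by rewrite /S unfold_in; case: excluded_middle_informative => h; constructor.
have hS : divring_closed S.
  by split=> [|y z /SP Py /SP Pz|y z /SP Py /SP Pz]; apply/SP; auto.
exists (sub_field hS), (val : {rmorphism sub_field hS -> F}) => z.
split=> [/SP Pz|[[c cS] /= <-]].
  by exists (SubFieldElt Pz).
exact/SP.
Qed.

(** * Orders of q modulo the integers of the collection *)

Section OrderArithmetic.

Local Open Scope nat_scope.

Lemma dvdn_subX1 n a m : n %| a - 1 -> n %| a ^ m - 1.
Proof.
by move=> h; apply: dvdn_trans h _; rewrite -{2}[1](exp1n m) subn_exp dvdn_mulr.
Qed.

Lemma is_ord_dvd n l r m : 0 < l -> is_ord n l r -> n %| l ^ m - 1 -> r %| m.
Proof.
move=> l0 [r0 nr rmin] nm; have l0' e : 0 < l ^ e by rewrite expn_gt0 l0.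
have mod1 e : (n %| l ^ e - 1) = (l ^ e == 1 %[mod n]) by rewrite eqn_mod_dvd.
rewrite /dvdn; apply: contraT => b_nz; have := rmin (m %% r).
rewrite lt0n b_nz leqNgt ltn_mod r0; apply=> //; move: nm nr; rewrite !mod1 => nm /eqP nr.
have lmE : l ^ m = (l ^ r) ^ (m %/ r) * l ^ (m %% r).
  by rewrite -expnM -expnD mulnC -divn_eq.
by rewrite lmE -modnMml -modnXm nr modnXm exp1n modnMml mul1n in nm.
Qed.

(** Induction on n. If l is a prime divisor of n and C = B^(n / l), then C^l - 1 is (C -
    1) (1 + C + ... + C^(l-1)), and the second factor is divisible by l since C = 1
    modulo l. *)
Lemma dvdn_exp_sub1 n B : 0 < n -> 0 < B -> (forall p, prime p -> p %| n -> p %| B - 1) ->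
  n %| B ^ n - 1.
Proof.
move=> + B0; have [N] := ubnP n; elim: N n => // N IH n ltN n0 hp.
have [->|n1] := eqVneq n 1; first exact: dvd1n.
have n_gt1 : 1 < n by lia.
have p_pr := pdiv_prime n_gt1; set p := pdiv n in p_pr.
have p_n : p %| n := pdiv_dvd n.
have nE : n = (n %/ p) * p by rewrite divnK.
set n' := n %/ p in nE.
have n'0 : 0 < n' by move: n0; rewrite nE muln_gt0 => /andP[].
have h' : n' %| B ^ n' - 1.
  apply: IH => //.
    move: ltN; rewrite ltnS nE; apply: leq_trans.
    by rewrite -{1}[n']muln1 ltn_pmul2l // prime_gt1.
  by move=> l l_pr l_n'; apply: hp => //; rewrite nE dvdn_mulr.
rewrite {2}nE expnM -{1}[1](exp1n p) subn_exp {1}nE dvdn_mul //.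
have e1 : B ^ n' = 1 %[mod p].
  by apply/eqP; rewrite eqn_mod_dvd ?expn_gt0 ?B0 // dvdn_subX1 // hp.
apply/eqP; rewrite -modn_summ (eq_bigr (fun=> 1 %% p)) ?sum_nat_const ?card_ord.
  by rewrite modnMmr muln1 modnn.
by move=> i _; rewrite exp1n muln1 -modnXm e1 modnXm exp1n.
Qed.

Section FrobeniusOrder.

Variables (q kappa n : nat).
Hypotheses (q_pr : prime q) (nI : in_I_Frob kappa q q n) (k_gt0 : 0 < kappa).

Let q_gt0 : 0 < q. Proof. exact: prime_gt0. Qed.

Lemma Frob_coprime : coprime n q.
Proof.
have [n0 hp] := nI; rewrite coprime_sym prime_coprime //; apply/negP => q_n.
by have [] := hp q q_pr q_n.
Qed.

(** If M is a common multiple of the prime-to-q parts of the orders modulo the prime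
    divisors of n, then q^(q^kappa M) is 1 modulo each of them, and its n-th power is 1
    modulo n; here n is prime to q. *)
Lemma Frob_lift : exists2 M, coprime M q & n %| q ^ (q ^ kappa * M) - 1.
Proof.
have [n0 hp] := nI.
(* S is the product of the prime-to-q parts of the orders modulo the primes dividing n.
   *)
have [S Sq Sp] : exists2 S, coprime S q &
    forall p, p \in primes n -> p %| q ^ (q ^ kappa * S) - 1.
  have : {subset primes n <= primes n} by [].
  elim: {1 3}(primes n) => [|p s IH] sub; first by exists 1; rewrite ?coprime1n.
  have [|S Sq Sp] := IH; first by move=> l ls; apply: sub; rewrite inE ls orbT.
  have := sub p (mem_head _ _); rewrite mem_primes => /and3P[p_pr _ p_n].
  have [_ _ [r [r0 pr _] vr]] := hp p p_pr p_n.
  exists (S * r`_q^') => [|l].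
    by rewrite coprimeMl Sq coprime_sym (@pnat_coprime q) ?part_pnat ?pnat_id.
  rewrite inE => /orP[/eqP->|/Sp].
    have -> : q ^ kappa * (S * r`_q^') = r * S.
      by rewrite -{2}(partnC q r0) p_part vr; lia.
    by rewrite expnM dvdn_subX1.
  by move=> h; rewrite mulnA expnM; apply: dvdn_subX1.
exists (S * n); first by rewrite coprimeMl Sq Frob_coprime.
rewrite mulnA expnM; apply: dvdn_exp_sub1; rewrite ?expn_gt0 ?q_gt0 //.
by move=> p p_pr p_n; apply: Sp; rewrite mem_primes p_pr n0.
Qed.

Variables (k' d0 : nat).
Hypotheses (n_gt1 : 1 < n) (ord_n : is_ord n q (q ^ k' * d0)) (d0q : ~~ (q %| d0)).

Let d0_gt0 : 0 < d0. Proof. by case: d0 d0q => //; rewrite dvdn0. Qed.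

(** The valuation at q of the order of q modulo n is kappa: at least kappa because of a
    prime divisor, at most kappa by Frob_lift. *)
Lemma Frob_exponent : k' = kappa.
Proof.
have [n0 hp] := nI; apply/eqP; rewrite eqn_leq; apply/andP; split.
  have [M Mq nM] := Frob_lift; have := is_ord_dvd q_gt0 ord_n nM.
  move/(dvdn_trans (dvdn_mulr d0 (dvdnn (q ^ k')))).
  by rewrite Gauss_dvdl ?dvdn_Pexp2l ?prime_gt1 // coprimeXl // coprime_sym.
have p_pr := pdiv_prime n_gt1; have [_ _ [r rord <-]] := hp _ p_pr (pdiv_dvd n).
have [_ nord _] := ord_n.
have := is_ord_dvd q_gt0 rord (dvdn_trans (pdiv_dvd n) nord).
move/(dvdn_leq_log q) => /(_ _)/leq_trans -> //.
  by rewrite muln_gt0 expn_gt0 q_gt0 d0_gt0.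
by rewrite lognM ?expn_gt0 ?q_gt0 // pfactorK // lognE q_pr d0_gt0 (negPf d0q) addn0.
Qed.

(** A common prime divisor would have an order dividing q^(kappa - 1) d0, whose
    valuation at q is less than kappa. *)
Lemma Frob_coprime_sub1 : coprime n (q ^ (q ^ (kappa - 1) * d0) - 1).
Proof.
have [n0 hp] := nI; rewrite coprime_has_primes //; last first.
  rewrite subn_gt0 -{1}(expn0 q) ltn_exp2l ?prime_gt1 //.
  by rewrite muln_gt0 expn_gt0 q_gt0 d0_gt0.
apply/hasPn => p; rewrite !mem_primes => /and3P[p_pr _ p_d]; apply/negP => /and3P[_ _ p_n].
have [_ _ [r rord vr]] := hp p p_pr p_n.
have := is_ord_dvd q_gt0 rord p_d; move/(dvdn_leq_log q).
rewrite vr lognM ?expn_gt0 ?q_gt0 // pfactorK // lognE q_pr d0_gt0 (negPf d0q) addn0.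
by rewrite muln_gt0 expn_gt0 q_gt0 d0_gt0 => /(_ isT); lia.
Qed.

End FrobeniusOrder.

End OrderArithmetic.

(** * The constant field and its extension of degree q *)

Section Frobenius.

Variables (p : nat) (F : comNzRingType).
Local Notation q := p.+2.
Hypothesis chF : q \in [pchar F].

Definition Fr n (z : F) := z ^+ (q ^ n).

Lemma FrE n z : Fr n.+1 z = pFrobenius_aut chF (Fr n z).
Proof. by rewrite pFrobenius_autE /Fr expnSr exprM. Qed.

Lemma Fr_add m n z : Fr (m + n) z = Fr n (Fr m z).
Proof. by rewrite /Fr expnD exprM. Qed.

Lemma FrD n y z : Fr n (y + z) = Fr n y + Fr n z.
Proof. by elim: n => [//|n IH]; rewrite !FrE IH rmorphD. Qed.

Lemma FrN n y : Fr n (- y) = - Fr n y.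
Proof. by elim: n => [//|n IH]; rewrite !FrE IH rmorphN. Qed.

Lemma FrM n y z : Fr n (y * z) = Fr n y * Fr n z.
Proof. exact: exprMn. Qed.

Lemma FrX n y m : Fr n (y ^+ m) = Fr n y ^+ m.
Proof. by rewrite /Fr exprAC. Qed.

Lemma Fr_nat n m : Fr n m%:R = m%:R.
Proof. by elim: n => [//|n IH]; rewrite !FrE IH rmorph_nat. Qed.

Lemma Fr_sum n I (s : seq I) (G : I -> F) :
  Fr n (\sum_(i <- s) G i) = \sum_(i <- s) Fr n (G i).
Proof.
elim: s => [|i s IH]; last by rewrite !big_cons FrD IH.
by rewrite !big_nil -[0]/(0%:R : F) Fr_nat.
Qed.

Lemma Fr_fix n m z : Fr n z = z -> Fr (n * m) z = z.
Proof.
by move=> h; elim: m => [|m IH]; rewrite ?muln0 // mulnS Fr_add h IH.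
Qed.

Lemma Fr_horner n (P : {poly F}) z : (forall i, Fr n P`_i = P`_i) -> Fr n P.[z] = P.[Fr n z].
Proof.
move=> h; rewrite !horner_coef Fr_sum; apply: eq_bigr => i _.
by rewrite FrM FrX h.
Qed.

End Frobenius.

Section BaseField.

Variables (p : nat) (Om : closedFieldType) (ep : nat).
Local Notation q := p.+2.
Hypotheses (chOm : q \in [pchar Om]) (ep_gt0 : (0 < ep)%N).
Local Notation Phi := (@Fr p Om).

(** The union of the fields with q^(ep m) elements, m prime to q. *)
Definition base_pred (z : Om) := exists2 m, coprime m q & Phi (ep * m) z = z.

Lemma base_pred1 : base_pred 1.
Proof. by exists 1%N; rewrite ?coprime1n // -[1]/(1%:R) Fr_nat. Qed.

Lemma base_pred_common y z : base_pred y -> base_pred z ->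
  exists2 m, coprime m q & Phi (ep * m) y = y /\ Phi (ep * m) z = z.
Proof.
move=> [m mq ym] [m' m'q zm']; exists (m * m')%N; first by rewrite coprimeMl mq.
split; first by rewrite mulnA; apply: Fr_fix.
by rewrite [(m * m')%N]mulnC mulnA; apply: Fr_fix.
Qed.

Lemma base_predB y z : base_pred y -> base_pred z -> base_pred (y - z).
Proof.
by move=> Py /(base_pred_common Py)[m mq [ym zm]]; exists m; rewrite // FrD // FrN // ym zm.
Qed.

Lemma base_predV y z : base_pred y -> base_pred z -> base_pred (y / z).
Proof.
move=> Py /(base_pred_common Py)[m mq [ym zm]]; exists m; rewrite // FrM ym.
by rewrite /Fr exprVn -/(Phi _ z) zm.
Qed.

Lemma Artin_Schreier_generator : exists x0, Phi ep x0 = x0 + 1.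
Proof.
have Q1 : (1 < q ^ ep)%N by rewrite -{1}(expn0 q) ltn_exp2l.
have sz : size ('X^(q ^ ep) - 'X - 1 : {poly Om}) = (q ^ ep).+1.
  rewrite -addrA size_polyDl size_polyXn // (leq_ltn_trans (size_polyD _ _)) //.
  by rewrite !size_polyN size_polyX size_poly1.
have /closed_rootP[x0] : size ('X^(q ^ ep) - 'X - 1 : {poly Om}) != 1%N.
  by rewrite sz eqSS -lt0n (ltnW Q1).
rewrite /root !hornerE subr_eq0 subr_eq => /eqP e.
by exists x0; rewrite /Fr e addrC.
Qed.

Variables (k : fieldType) (j : {rmorphism k -> Om}).
Hypothesis jP : forall z, base_pred z <-> exists c, j c = z.
Variable x0 : Om.
Hypothesis x0E : Phi ep x0 = x0 + 1.

Lemma pchar_base : q \in [pchar k].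
Proof. by rewrite -(fmorph_pchar j). Qed.

Lemma Fr_x0 m : Phi (ep * m) x0 = x0 + m%:R.
Proof.
elim: m => [|m IH]; first by rewrite muln0 /Fr expr1 addr0.
by rewrite mulnS Fr_add x0E FrD // IH -[1]/(1%:R) Fr_nat // -addrA -natrD addn1.
Qed.

Lemma Artin_Schreier_coef : exists al, x0 ^+ q - x0 = j al.
Proof.
have [|al <-] := (jP (x0 ^+ q - x0)).1; last by exists al.
exists 1%N; first exact: coprime1n.
rewrite FrD // FrN // FrX Fr_x0 frobD // expr1n opprD addrACA.
by rewrite subrr addr0.
Qed.

Lemma base_coef_common (c : {poly k}) :
  exists2 m, coprime m q & forall i, Phi (ep * m) (j c`_i) = j c`_i.
Proof.
suff [m mq h] : exists2 m, coprime m q & {in (c : seq k), forall b, Phi (ep * m) (j b) = j b}.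
  exists m => // i; have [le|lt] := leqP (size c) i; last by apply/h/mem_nth.
  by rewrite nth_default // rmorph0 -[0]/(0%:R) Fr_nat.
elim: (c : seq k) => [|b s [m mq h]]; first by exists 1%N; rewrite ?coprime1n.
have [m' m'q bm'] : base_pred (j b) by apply/jP; exists b.
exists (m * m')%N; first by rewrite coprimeMl mq.
move=> z; rewrite inE => /orP[/eqP->|/h zm]; last by rewrite mulnA; apply: Fr_fix.
by rewrite [(m * m')%N]mulnC mulnA; apply: Fr_fix.
Qed.

(** A power of Frobenius that fixes the coefficients of c moves the root x0 + i to x0 +
    i + m with m prime to q. If c vanished at one of these elements, it would have q
    roots. *)
Lemma Artin_Schreier_degree (c : {poly k}) : c != 0 -> (size c <= q)%N ->
  forall i : 'I_q, (map_poly j c).[x0 + res Om i] != 0.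
Proof.
move=> c_nz sc i; apply: contraNneq c_nz => c0.
have [m mq fixc] := base_coef_common c.
have rt n : (map_poly j c).[x0 + res Om (i + (n * m)%:R)] = 0.
  elim: n => [|n IH]; first by rewrite mul0n addr0.
  have -> : i + (n.+1 * m)%:R = i + (n * m)%:R + m%:R by rewrite mulSn natrD addrCA addrC.
  rewrite (resD chOm) (res_nat chOm) addrA.
  have hF := Fr_horner chOm (x0 + res Om (i + (n * m)%:R)) (n := ep * m) (P := map_poly j c).
  rewrite IH -[0]/(0%:R) (Fr_nat chOm) in hF; rewrite [RHS]hF => [|l]; last first.
    by rewrite coef_map fixc.
  congr (_.[_]); rewrite (FrD chOm) Fr_x0 /res (Fr_nat chOm).
  by rewrite addrAC.
(* Since m is a unit modulo q, its multiples give all conjugates. *)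
have m_unit : m%:R \is a @GRing.unit 'Z_q by rewrite unitZpE // coprime_sym.
pose rs := [seq x0 + res Om (i + (n : 'I_q) * m%:R) | n <- enum 'I_q].
have Urs : uniq rs.
  rewrite map_inj_uniq ?enum_uniq // => n n' /addrI/(res_inj chOm)/addrI.
  exact: (mulIr m_unit).
have : all (root (map_poly j c)) rs.
  apply/allP => _ /mapP[n _ ->]; apply/rootP.
  by rewrite -(rt n) natrM natr_Zp.
move=> ars; rewrite -(map_poly_eq0 j); apply: contraTT sc => jc_nz.
by have := max_poly_roots jc_nz ars Urs; rewrite size_map size_enum_ord size_map_poly ltnNge.
Qed.

Section RootOfUnity.

Variables (n d0 : nat) (zeta : Om).
Hypotheses (zeta_prim : n.-primitive_root zeta) (d0q : coprime d0 q).
Hypothesis zeta_fix : Phi (ep * d0 * q) zeta = zeta.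
Hypothesis n_coprime : coprime n (q ^ (ep * d0) - 1).
Local Notation D := (d0%:R : 'I_q).

Let D_unit : (d0%:R : 'Z_q) \is a GRing.unit.
Proof. by rewrite unitZpE // coprime_sym. Qed.

(** The conjugates of zeta under Fr (ep * d0). This automorphism maps x0 to x0 + d0, so
    numbering by l / d0 makes the index l match the conjugate x0 + l. *)
Definition conj_zeta (l : 'I_q) : Om := Phi (ep * d0 * ((l : 'Z_q) / D)) zeta.

Lemma conj_zeta0 : conj_zeta 0 = zeta.
Proof. by rewrite /conj_zeta mul0r muln0 /Fr expr1. Qed.

Lemma conj_zetaD l : conj_zeta (l + D) = Phi (ep * d0) (conj_zeta l).
Proof.
rewrite /conj_zeta -Fr_add.
have -> : (l + D : 'Z_q) / D = (l : 'Z_q) / D + 1 by rewrite mulrDl divrr.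
set v : 'Z_q := _ / _; have vE : nat_of_ord (v + 1) = (v.+1 %% q)%N.
  by rewrite -[v.+1]addn1.
rewrite vE -mulnSr; case: (ltngtP v.+1 q) => [lt|gt|->].
- by rewrite modn_small.
- by have := ltn_ord v; rewrite ltnNge -ltnS gt.
by rewrite modnn muln0 zeta_fix /Fr expr1.
Qed.

Lemma conj_zetaMn l m : conj_zeta (l + D * m%:R) = Phi (ep * d0 * m) (conj_zeta l).
Proof.
elim: m => [|m IH]; first by rewrite mulr0 addr0 muln0 /Fr expr1.
by rewrite mulrS mulrDr mulr1 [D + _]addrC addrA conj_zetaD IH -Fr_add mulnS addnC.
Qed.

Lemma conj_zeta_order l : conj_zeta l ^+ n = 1.
Proof. by rewrite /conj_zeta -FrX (prim_expr_order zeta_prim) /Fr expr1n. Qed.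

(** The hypothesis gives zeta^m = zeta^(m q^(ep d0)), and q^(ep d0) - 1 is prime to n.
    *)
Lemma conj_zeta_const m : (forall l, conj_zeta (l + 1) ^+ m = conj_zeta l ^+ m) -> (n %| m)%N.
Proof.
move=> h; have hl s : conj_zeta s%:R ^+ m = zeta ^+ m.
  by elim: s => [|s IH]; rewrite ?conj_zeta0 // mulrSr h IH.
have := hl d0; have := conj_zetaD 0; rewrite add0r conj_zeta0 => -> /eqP.
rewrite /Fr -exprM (eq_prim_root_expr zeta_prim) eqn_mod_dvd; last first.
  by rewrite leq_pmull // expn_gt0.
by rewrite -{2}[m]mul1n -mulnBl Gauss_dvdr.
Qed.

(** Interpolation by trace_dual: the trace coordinates of zeta are invariant under Fr
    (ep * d0), which permutes the conjugates, and so belong to k. *)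
Lemma conj_zeta_poly : exists f : {poly k},
  forall l, (map_poly j f).[x0 + res Om l] = conj_zeta l.
Proof.
pose y (s : 'I_q) : Om := \sum_i (x0 + res Om i) ^+ s * conj_zeta i.
have /fin_all_exists[u uE] s : exists c, j c = y s.
  apply/jP; exists d0 => //; rewrite Fr_sum // [RHS](reindex_inj (addIr D)) /=.
  apply: eq_bigr => i _; rewrite FrM FrX -conj_zetaD; congr (_ ^+ _ * _).
  rewrite FrD // Fr_x0 /res Fr_nat // -/(res Om i) -/(res Om (i + D)).
  by rewrite resD // res_nat // -addrA [_ + d0%:R]addrC.
exists ((u 0)%:P - \sum_(s < q) u (rev_ord s) *: 'X^s) => l.
rewrite rmorphB rmorph_sum hornerD hornerN horner_sum /= map_polyC hornerC.
rewrite -(@trace_dual p Om chOm x0 conj_zeta y l) //; congr (_ - _); first exact: uE.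
by apply: eq_bigr => s _; rewrite map_polyZ /= map_polyXn hornerZ hornerXn uE.
Qed.

End RootOfUnity.
End BaseField.

(** * Roots of unity and Frobenius characters *)

Lemma closed_field_prim_root (F : closedFieldType) n : (0 < n)%N -> n%:R != 0 :> F ->
  exists z : F, n.-primitive_root z.
Proof.
move=> n0 nF; have [rs rsE] := closed_field_poly_normal ('X^n - 1 : {poly F}).
have lc : lead_coef ('X^n - 1 : {poly F}) = 1.
  by rewrite lead_coefDl ?lead_coefXn // size_polyXn size_polyN size_poly1.
rewrite lc scale1r in rsE.
have /hasP[z _ zP] : has n.-primitive_root rs; last by exists z.
apply: has_prim_root => //.
- by apply/allP => z zrs; rewrite /root_of_unity rsE root_prod_XsubC.
- by rewrite -separable_prod_XsubC -rsE separable_Xn_sub_1.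
have := size_prod_XsubC rs id; rewrite -rsE size_polyDl ?size_polyXn ?size_polyN ?size_poly1 //.
by case=> ->.
Qed.

Section FrobeniusElement.

Variables (p kappa : nat) (Om : closedFieldType).
Local Notation q := p.+2.
Local Notation ep := (q ^ (kappa - 1))%N.
Hypotheses (q_pr : prime q) (chOm : q \in [pchar Om]) (k_gt0 : (0 < kappa)%N).
Variables (k : fieldType) (j : {rmorphism k -> Om}).
Hypothesis jP : forall z, base_pred p ep z <-> exists c, j c = z.
Variable x0 : Om.
Hypothesis x0E : Fr p ep x0 = x0 + 1.

(** The polynomial f represents a primitive n-th root of unity in k(x0). By assumption
    chi(y) is the power d of Fr (ep * d0) for a generator y, and Fr (ep * d0) translates
    the index of the conjugates by d0; so chi(y) becomes the translation by d0 d. For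
    general z this is rescaled by z / y. *)
Lemma Frobenius_element n (chi : mu_hom q n) :
    in_I_Frob kappa q q n -> Frobenius_type q chi ->
  exists (f : {poly k}) (sg : 'I_q),
    let c l := (map_poly j f).[x0 + res Om l] in
    [/\ forall z : 'I_q, z * sg = 0 -> z = 0,
        forall l, c l ^+ n = 1,
        forall (z : 'Z_q) l, c (l - z * sg) = c l ^+ (val (chi z) : nat)
      & forall m, (forall l, c (l + 1) ^+ m = c l ^+ m) -> (n %| m)%N].
Proof.
move=> nI; have [n0 _] := nI; have [n1 _|n_ne1] := eqVneq n 1%N.
  exists 1, 1; rewrite /= rmorph1; split=> [z|l|z l|m _].
  - by rewrite mulr1.
  - by rewrite hornerC expr1n.
  - by rewrite !hornerC expr1n.
  - by rewrite n1 dvd1n.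
case=> [n1|[y [k' [d0 [d [gen_y ord_n [k'0 d0q] /andP[d1 dq] chiE]]]]]].
  by rewrite n1 eqxx in n_ne1.
have n_gt1 : (1 < n)%N by lia.
have k'E := Frob_exponent q_pr nI k_gt0 n_gt1 ord_n d0q; rewrite {}k'E in ord_n chiE.
have n_sub1 := Frob_coprime_sub1 q_pr nI k_gt0 n_gt1 d0q.
have d0_co : coprime d0 q by rewrite coprime_sym prime_coprime.
have [|zeta zeta_prim] := @closed_field_prim_root Om n n0.
  rewrite -(dvdn_pcharf chOm); have := Frob_coprime q_pr nI.
  by rewrite coprime_sym prime_coprime.
have kE : (q ^ kappa = ep * q)%N by rewrite -expnSr subn1 prednK.
have zeta_fix : Fr p (ep * d0 * q) zeta = zeta.
  have [_ nord _] := ord_n; apply/eqP; rewrite /Fr -{2}[zeta]expr1.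
  rewrite (eq_prim_root_expr zeta_prim) eqn_mod_dvd ?expn_gt0 //.
  by rewrite mulnAC -kE.
have [f fE] := conj_zeta_poly chOm jP x0E d0_co zeta_fix.
have q_gt1 : (1 < q)%N by [].
have unit_small m : (0 < m < q)%N -> (m%:R : 'Z_q) \is a GRing.unit.
  by move=> /andP[m0 mq]; rewrite unitZpE // prime_coprime // gtnNdvd.
have y_unit : y \is a GRing.unit.
  have /cycleP[m mE] : (1%R : 'Z_q) \in <[y]>.
    by move: gen_y; rewrite /generator => /eqP <-; rewrite mem_Zp.
  apply/unitrPr; exists m%:R; rewrite mulr_natr.
  by rewrite mE; elim: (m) => [//|s IH]; rewrite expgS mulrS -IH.
have D_unit : (d0%:R : 'Z_q) \is a GRing.unit by rewrite unitZpE // coprime_sym.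
have d_unit : (d%:R : 'Z_q) \is a GRing.unit.
  by apply: unit_small; rewrite d1 ltnS; move: dq; rewrite subn1.
pose sg : 'Z_q := - (y^-1 * d0%:R * d%:R).
have sg_unit : sg \is a GRing.unit by rewrite unitrN !unitrM unitrV y_unit D_unit d_unit.
exists f, sg; split=> [z zs|l|z l|m].
- exact: (mulIr sg_unit (etrans zs (esym (mul0r (sg : 'Z_q))))).
- by rewrite fE; apply: conj_zeta_order.
(* z is m times y, so chi z is the m-th power of chi y. *)
- pose m : nat := (z / y : 'Z_q).
  have zE : z = y * m%:R by rewrite /m natr_Zp mulrC divrK.
  have zsg : z * sg = - (d0%:R * (d * m)%:R : 'Z_q).
    rewrite /sg zE mulrN natrM; congr (- _).
    by rewrite [y * m%:R]mulrC -!mulrA mulVKr // mulrCA [m%:R * _]mulrC.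
  rewrite !fE zsg opprK conj_zetaMn // /Fr; set c := conj_zeta _ _ _ _.
  have cn : c ^+ n = 1 by apply: conj_zeta_order.
  rewrite -[LHS](expr_mod _ cn) -[RHS](expr_mod _ cn); congr (_ ^+ _).
  have -> : chi z = (chi y ^+ m)%g.
    by rewrite -morphX ?mem_Zp // zE FinRing.zmodXgE mulr_natr.
  rewrite FinRing.val_unitX -[val (chi y)]natr_Zp -natrX val_Zp_nat // modn_mod.
  rewrite -[RHS]modnXm chiE modnXm -expnM; congr (_ ^ _ %% _)%N.
  by rewrite mulnA; congr (_ * _)%N; rewrite -mulnA mulnC.
move=> h; apply: (conj_zeta_const zeta_prim d0_co zeta_fix n_sub1) => l.
by rewrite -!fE; apply: h.
Qed.

End FrobeniusElement.

(** * Semidirect products *)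

Section Semidirect.

Variables (p : nat).
Local Notation q := p.+2.
Variables (k : fieldType) (L : closedFieldType).
Variables (iota : {rmorphism {fraction {poly k}} -> L}) (al : k) (x r : L).
Hypothesis chk : q \in [pchar k].
Local Notation K := {fraction {poly k}}.
Local Notation a := (tofrac al%:P : K).
Local Notation t := (tofrac 'X : K).
Hypotheses (xa : x ^+ q - x = iota a) (rt : r ^+ q = iota t).

Let chK : q \in [pchar K] := pchar_frac chk.
Let chL : q \in [pchar L]. Proof. by rewrite (fmorph_pchar iota) chK. Qed.
Let kK : {rmorphism k -> K} := @FracField.tofrac {poly k} \o @polyC k.
Let ka : {rmorphism k -> L} := iota \o kK.

Variables (Om : fieldType) (j : {rmorphism k -> Om}) (x0 : Om).
Hypothesis x0a : x0 ^+ q - x0 = j al.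

(** Both equations mean that P and Q agree modulo the Artin-Schreier polynomial. *)
Lemma AS_transfer (P Q : {poly k}) :
  (forall l : 'I_q, (map_poly j P).[x0 + res Om l] = (map_poly j Q).[x0 + res Om l]) <->
  (forall l : 'I_q, (map_poly ka P).[x + res L l] = (map_poly ka Q).[x + res L l]).
Proof.
have xka : x ^+ q - x = ka al by exact: xa.
have horner_sub (S : fieldType) (phi : {rmorphism k -> S}) z :
    (map_poly phi P).[z] = (map_poly phi Q).[z] <-> (map_poly phi (P - Q)).[z] = 0.
  rewrite rmorphB hornerD hornerN; split=> [->|/eqP]; first exact: subrr.
  by rewrite subr_eq0 => /eqP.
split=> PQ l; apply/horner_sub; move: l.
  by apply/(AS_dvd_map chk _ xka)/(AS_dvd_map chk _ x0a) => l; apply/horner_sub.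
by apply/(AS_dvd_map chk _ x0a)/(AS_dvd_map chk _ xka) => l; apply/horner_sub.
Qed.

Lemma horner_shift (S : fieldType) (phi : {rmorphism k -> S}) (chS : q \in [pchar S])
    (f : {poly k}) (z : S) (i l : 'I_q) :
  (map_poly phi (f \Po ('X + (res k i)%:P))).[z + res S l] =
  (map_poly phi f).[z + res S (l + i)].
Proof.
rewrite map_comp_poly horner_comp rmorphD /= map_polyX map_polyC !hornerE.
by rewrite (resD chS) addrA; congr (_.[_ + _]); apply: rmorph_res.
Qed.

Variables (n : nat) (n_gt0 : (0 < n)%N) (chi : mu_hom q n).
Variables (f : {poly k}) (sg : 'I_q).
Let c (l : 'I_q) := (map_poly j f).[x0 + res Om l].
Hypothesis sg_inj : forall z : 'I_q, z * sg = 0 -> z = 0.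
Hypothesis c_order : forall l, c l ^+ n = 1.
Hypothesis c_chi : forall (z : 'Z_q) l, c (l - z * sg) = c l ^+ (val (chi z) : nat).
Hypothesis c_const : forall m, (forall l, c (l + 1) ^+ m = c l ^+ m) -> (n %| m)%N.

Let cL (l : 'I_q) := (map_poly ka f).[x + res L l].

Let chOm : q \in [pchar Om]. Proof. by rewrite (fmorph_pchar j). Qed.

Lemma horner_mapX (S : fieldType) (phi : {rmorphism k -> S}) (P : {poly k}) m z :
  (map_poly phi (P ^+ m)).[z] = (map_poly phi P).[z] ^+ m.
Proof. by rewrite rmorphXn horner_exp. Qed.

Lemma cL_order l : cL l ^+ n = 1.
Proof.
rewrite /cL -horner_mapX ((AS_transfer (f ^+ n) 1).1 _ l) ?rmorph1 ?hornerC // => l'.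
by rewrite horner_mapX hornerC; apply: c_order.
Qed.

Lemma cL_chi (z : 'Z_q) l : cL (l - z * sg) = cL l ^+ (val (chi z) : nat).
Proof.
rewrite /cL -horner_mapX -horner_shift //; apply: (AS_transfer _ _).1 => l'.
by rewrite horner_mapX horner_shift //; apply: c_chi.
Qed.

Lemma cL_const m : (forall l, cL (l + 1) ^+ m = cL l ^+ m) -> (n %| m)%N.
Proof.
move=> h; apply: c_const; rewrite /c => l.
rewrite -!horner_mapX -horner_shift //; apply: (AS_transfer _ _).2 => l'.
by rewrite horner_shift // !horner_mapX; apply: h.
Qed.

Definition sd_shift (g : mu_sdprod chi) : 'I_q := (pair_of_sd g).1 * sg.
Definition sd_exp (g : mu_sdprod chi) : nat := (pair_of_sd g).2.

(** The pair (y, x) stands for the product y x, which is sent to u^s zeta^x, with s a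
    multiple of y and zeta represented by f; moving zeta^x to the left of u^s translates
    its index by s. *)
Definition sd_coef (g : mu_sdprod chi) (s : 'I_q) : {poly K} :=
  if s == sd_shift g then map_poly kK ((f \Po ('X + (res k s)%:P)) ^+ sd_exp g) else 0.

Lemma alg_mx_sd g i l : alg_mx iota x r (sd_coef g) i l =
  (r ^+ sd_shift g * cL l ^+ sd_exp g) *+ (l - i == sd_shift g).
Proof.
rewrite mxE /sd_coef; case: eqP => [<-|_]; last by rewrite rmorph0 horner0 mulr0.
rewrite mulr1n -map_poly_comp -[map_poly _ _]/(map_poly ka _) rmorphXn horner_exp.
by rewrite (horner_shift ka) // subrKC.
Qed.

Lemma sd_exp_mul g h l : cL l ^+ sd_exp (g * h)%g =
  cL (l - sd_shift h) ^+ sd_exp g * cL l ^+ sd_exp h.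
Proof.
rewrite cL_chi -exprM -exprD.
have [n1|n_ne1] := eqVneq n 1%N.
  have c1 : cL l = 1 by rewrite -[LHS]expr1 -[X in _ ^+ X]n1 cL_order.
  by rewrite c1 !expr1n.
have n_gt1 : (1 < n)%N by rewrite ltn_neqAle eq_sym n_ne1.
rewrite -[LHS](expr_mod _ (cL_order l)) -[RHS](expr_mod _ (cL_order l)).
congr (_ ^+ _); rewrite /sd_exp.
have -> : (pair_of_sd (g * h)%g).2 =
    ((pair_of_sd g).2 : 'Z_n) * val (chi (pair_of_sd h).1) + (pair_of_sd h).2 by [].
set u : 'Z_n := (pair_of_sd g).2; set v : 'Z_n := val _; set w : 'Z_n := (pair_of_sd h).2.
have -> : u * v + w = (v * u + w)%N%:R :> 'Z_n.
  by rewrite natrD natrM !natr_Zp mulrC.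
by rewrite val_Zp_nat // modn_mod.
Qed.

(** The relation of chi with translations of the index is the commutation rule of the
    semidirect product. A scalar matrix forces the shift to vanish and zeta^x to be
    invariant under conjugation, hence x = 0. *)
Theorem semidirect_embeds : embeds_in_Aut iota (mu_sdprod chi) (SB p a t).
Proof.
have tnz := t_nz k.
apply: (embeds_in_Aut_SB chK tnz xa rt (frac_infinite k) (e := sd_coef)) => [|g h|g b e].
- apply/matrixP=> i l; rewrite alg_mx_sd mxE.
  rewrite /sd_shift /sd_exp /= mul0r subr_eq0 eq_sym !expr0 mulr1.
  by [].
- have sdM : sd_shift (g * h)%g = sd_shift g + sd_shift h := mulrDl _ _ _.
  pose b := iota t ^+ carry (sd_shift g) (sd_shift h).
  have rE : r ^+ sd_shift g * r ^+ sd_shift h = r ^+ sd_shift (g * h)%g * b.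
    by rewrite sdM (expr_carry _ _ rt).
  have b_nz : b != 0 by rewrite expf_neq0 // fmorph_eq0.
  exists b^-1; rewrite ?invr_neq0 //; apply: (canRL (scalerK b_nz)).
  apply/matrixP=> i l; rewrite mxE alg_mx_sd [RHS]mxE.
  rewrite (bigD1 (i + sd_shift g)) //= big1 => [|l' ne]; last first.
    by rewrite alg_mx_sd subr_eq addrC (negPf ne) mulr0n mul0r.
  rewrite !alg_mx_sd addr0 addrAC subrr add0r eqxx mulr1n.
  have -> : (l - i == sd_shift (g * h)%g) = (l - (i + sd_shift g) == sd_shift h).
    by rewrite sdM opprD addrA [RHS]subr_eq [sd_shift h + _]addrC.
  case: eqP => [le|_]; last by rewrite !mulr0n !mulr0.
  have -> : i + sd_shift g = l - sd_shift h by rewrite -le subKr.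
  rewrite !mulr1n sd_exp_mul.
  rewrite [RHS]mulrACA rE [LHS]mulrA; congr (_ * _); apply: mulrC.
(* A nonzero shift would give a nonzero entry off the diagonal. *)
have [s0|s_nz] := eqVneq (sd_shift g) 0; last first.
  have := congr1 (fun M : 'M_q => M 0 (sd_shift g)) e; rewrite alg_mx_sd mxE subr0 eqxx mulr1n.
  rewrite [0 == _]eq_sym (negPf s_nz) mulr0n => /eqP; rewrite mulf_eq0 !expf_eq0.
  rewrite (negPf (r_nz tnz rt)) andbF /= => /andP[_ /eqP cL0].
  have := cL_order (sd_shift g); rewrite cL0 expr0n eqn0Ngt n_gt0 => /eqP.
  by rewrite eq_sym oner_eq0.
have const_g l : cL l ^+ sd_exp g = b.
  have := congr1 (fun M : 'M_q => M l l) e.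
  by rewrite alg_mx_sd mxE subrr s0 eqxx !mulr1n expr0 mul1r.
have dvd : (n %| sd_exp g)%N by apply: cL_const => l; rewrite !const_g.
have g1 := sg_inj s0; move: (valP g) dvd; rewrite inE => /andP[_ g2Z].
rewrite /sd_exp => dvd; apply: val_inj; rewrite [LHS]surjective_pairing /= g1.
congr (_, _); have [n_le1|n_gt1] := leqP n 1.
  by move: g2Z; rewrite /= /Zp ltnNge n_le1 => /set1gP.
have lt : ((pair_of_sd g).2 < n)%N by rewrite -[X in (_ < X)%N](Zp_cast n_gt1) ltn_ord.
apply: val_inj; case: (posnP (pair_of_sd g).2) => // gt0.
by move: lt; rewrite ltnNge dvdn_leq.
Qed.

End Semidirect.

(** * Frobenius collections *)

Theorem theorem10 (q : nat) (q_prime : prime q) (q_ge3 : (3 <= q)%N)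
    (Fqbar : closedFieldType) (eps : {rmorphism 'F_q -> Fqbar})
    (Fqbar_alg : integralRange eps)
    (C : collection q) (C_Frobenius : Frobenius_collection q C) :
  exists (k : fieldType) (_ : {rmorphism k -> Fqbar})
         (X : proj_scheme {fraction {poly k}}),
  forall (Kbar : closedFieldType)
         (iota : {rmorphism {fraction {poly k}} -> Kbar}),
    integralRange iota ->
    [/\ nontrivial_Severi_Brauer iota (q - 1)%N X,
        forall n (chi : mu_hom q n), C n chi ->
          embeds_in_Aut iota (mu_sdprod chi) X
      & forall N : nat, (0 < N)%N ->
          embeds_in_Aut iota 'rV['Z_q]_N X].
Proof.
have chO : q \in [pchar Fqbar] by rewrite (fmorph_pchar eps) pchar_Fp.
case: C_Frobenius => _ [kappa [k_gt0 CF]].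
case: q q_prime q_ge3 {eps Fqbar_alg} C CF chO => [|[|p]] // q_pr _ C CF chO.
pose ep := (p.+2 ^ (kappa - 1))%N.
have ep_gt0 : (0 < ep)%N by rewrite expn_gt0.
have [k [j jP]] := subfield_of_Prop (base_pred1 ep chO)
  (@base_predB p Fqbar ep chO) (@base_predV p Fqbar ep).
have [x0 x0E] := Artin_Schreier_generator p Fqbar ep_gt0.
have chk := pchar_base chO j.
have [al alE] := Artin_Schreier_coef chO jP x0E.
exists k, j, (SB p (tofrac al%:P) (tofrac 'X)) => Kbar iota _.
have [x xa] : exists x, x ^+ p.+2 - x = iota (tofrac al%:P).
  have /closed_rootP[x] : size (AS p (iota (tofrac al%:P))) != 1%N by rewrite size_AS.
  by rewrite /root /AS !hornerE subr_eq0 => /eqP; exists x.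
have [r rt] : exists r, r ^+ p.+2 = iota (tofrac 'X).
  have /closed_rootP[r] : size ('X^(p.+2) - (iota (tofrac 'X))%:P) != 1%N.
    by rewrite size_XnsubC.
  by rewrite /root !hornerE subr_eq0 => /eqP; exists r.
have chK := pchar_frac chk; have tnz := t_nz k.
split=> [|n chi Cchi|M _].
- split; first exact: (SB_Severi_Brauer chK tnz xa rt (@frac_infinite k)).
  move=> /(trivial_norm chK tnz xa rt)[Y0 [Y1 [Y0_nz sY0 sY1]]].
  apply/negP; apply: (not_norm alE) => //.
  exact: (Artin_Schreier_degree chO jP x0E).
- have [nI chiF] := CF n chi Cchi.
  have [f [sg [sg_inj c_ord c_chi c_const]]] := Frobenius_element q_pr chO k_gt0 jP x0E nI chiF.
  exact: (semidirect_embeds chk xa rt alE nI.1 sg_inj c_ord c_chi c_const).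
exact: (elementary_abelian_embeds chk xa rt).
Qed.
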